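(* Suppose that $k_{ij}$ is positive definite, i.e. $k_m\xi_i\xi_i\le k_{ij}\xi_i\xi_j\le k_M\xi_i\xi_i$ for all $\xi\in\mathbb{R}^3$, where $k_m(\mathbf{x})>0$ and $k_M(\mathbf{x})$ are the lowest and the greatest eigenvalues of $k_{ij}(\mathbf{x})$; that the delay times satisfy either $0\le\frac12\tau_q\le\tau_T$ or $0<\tau_T<\frac12\tau_q$; and that $a>0$. Then the solution $\mathcal{S}=\{T,q_i\}$ of the initial boundary value problem $\mathcal{P}$ corresponding to the data $\mathcal{D}=\{r;T^0,q_i^0,\dot q_i^0;0,0\}$ (zero boundary data) depends continuously on these data on any finite time interval $[0,S]$, $S>0$. More precisely, for every $t\in[0,S]$: (i) when $0\le\tau_q\le2\tau_T$, $$\sqrt{\mathcal{E}(t)}\le\frac{1}{\sqrt2}\int_0^t g(s)\,ds+\left\{\frac S2\int_B\left[a\tilde T^2(0)+\frac12\tau_T\tau_q^2K_{ij}q_i^0q_j^0+\frac{\tau_T}{K_m}\varphi_i\varphi_i\right]dv+\frac{S^2}{4}\int_B\frac1{K_m}\varphi_i\varphi_i\,dv\right\}^{1/2},$$ where $$g(t)=\left[\int_0^t\int_B\frac1a\,\big(R^{*}(s)\big)^2\,dv\,ds\right]^{1/2};$$ (ii) when $0<2\tau_T<\tau_q$, $$\sqrt{\mathcal{F}(t)}\le\frac{1}{\sqrt2}\int_0^t e^{\sigma^2(t-s)}g(s)\,ds+e^{\sigma^2t}\left\{\frac S2\int_B\left[a\tilde T^2(0)+\frac12\tau_T\tau_q^2K_{ij}q_i^0q_j^0+\frac{\tau_T}{K_m}\varphi_i\varphi_i\right]dv+\frac{S^2}{4}\int_B\frac1{K_m}\varphi_i\varphi_i\,dv\right\}^{1/2},$$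 with the same $g$ and with $$\mathcal{F}(t)=\mathcal{E}(t)+\frac14\tau_T\tau_q^2\int_0^t\int_BK_{ij}q_i(s)q_j(s)\,dv\,ds,\qquad \sigma^2=\frac1{\tau_T}-\frac2{\tau_q}.$$
   Context: Summation over repeated indices is used, indices range over $\{1,2,3\}$, and a comma followed by $i$ denotes $\partial/\partial x_i$. $B\subset\mathbb{R}^3$ is a regular region (a bounded domain to which the divergence theorem applies) with closure $\overline B$, boundary $\partial B$ and outward unit normal $n_i$; $dv$ is the volume element. $\Sigma_1,\Sigma_2\subset\partial B$ satisfy $\overline\Sigma_1\cup\Sigma_2=\partial B$ and $\Sigma_1\cap\Sigma_2=\emptyset$. The coefficients $a(\mathbf{x})$, $\varrho(\mathbf{x})$ and the symmetric tensor $k_{ij}(\mathbf{x})$ are given, time-independent, and sufficiently regular on $\overline B$; the constants $\tau_q\ge0$, $\tau_T\ge0$ are the delay times. Problem $\mathcal{P}$: given smooth data $\mathcal{D}=\{r;T^0,q_i^0,\dot q_i^0;\vartheta,\xi\}$, find $\mathcal{S}=\{T,q_i\}$ on $\overline B\times[0,\infty)$ such that on $B\times(0,\infty)$ $$q_i+\tau_q\frac{\partial q_i}{\partial t}+\frac12\tau_q^2\frac{\partial^2 q_i}{\partial t^2}=-k_{ij}T_{,j}-\tau_T k_{ij}\frac{\partial T_{,j}}{\partial t},\qquad -q_{i,i}+\varrho r=a\frac{\partial T}{\partial t},$$ with initial conditions $T(\mathbf{x},0)=T^0(\mathbf{x})$, $q_i(\mathbf{x},0)=q_i^0(\mathbf{x})$,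 $\frac{\partial q_i}{\partial t}(\mathbf{x},0)=\dot q_i^0(\mathbf{x})$ on $\overline B$, and boundary conditions $T=\vartheta$ on $\overline\Sigma_1\times[0,\infty)$, $q_in_i=\xi$ on $\Sigma_2\times[0,\infty)$. A solution is a pair $\{T,q_i\}$ defined on $\overline B\times[0,\infty)$ with $T\in C^{1,1}(B\times(0,\infty))$ and $q_i\in C^{1,2}(B\times(0,\infty))$ (the first superscript refers to space derivatives, the second to time derivatives, the mixed derivatives appearing in the equations being included), satisfying the equations, initial and boundary conditions. Solutions are classical: the fields and the derivatives occurring in the equations and conditions are assumed regular enough up to $\partial B$ and $t=0$ for the conditions to be meaningful and the divergence theorem to be applicable. Notation. For a function of time, $f'(t)=\int_0^tf(s)\,ds$ (a prime denotes time integration, not differentiation), and $\tilde h(t)=h'(t)+\tau_Th(t)$; thus $\tilde T(t)=\int_0^tT(s)\,ds+\tau_TT(t)$, $\tilde T(\mathbf{x},0)=\tau_TT^0(\mathbf{x})$, and $\tilde r(t)=\int_0^tr(s)\,ds+\tau_Tr(t)$. $K_{ij}$ is the inverse tensor of $k_{ij}$ ($k_{ij}K_{jk}=K_{ij}k_{jk}=\delta_{ik}$), and $K_m(\mathbf{x})$ is its lowest eigenvalue. Further, $$R^*(\mathbf{x},t)=\varrho\,\tilde r(\mathbf{x},t)+aT^0(\mathbf{x}),\qquad \varphi_i(\mathbf{x})=\tau_TT^0_{,i}(\mathbf{x})+K_{ij}\left[\tau_qq_j^0(\mathbf{x})+\frac12\tau_q^2\dot q_j^0(\mathbf{x})\right],$$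 $$\mathcal{E}(t)=\frac12\int_0^t\int_Ba\tilde T^2(s)\,dv\,ds+\frac12\int_0^t\int_0^s\int_BK_{ij}q'_i(z)q'_j(z)\,dv\,dz\,ds,\quad t\ge0.$$ *)

(* Defs.v *)
(* MathComp-Analysis, over an arbitrary R : realType. *)
From HB Require Import structures.
From mathcomp Require Import all_boot all_order all_algebra.
From mathcomp Require Import all_classical all_reals all_analysis.

Set Implicit Arguments.
Unset Strict Implicit.
Unset Printing Implicit Defensive.

Import Order.TTheory GRing.Theory Num.Theory.
Import numFieldNormedType.Exports.

Local Open Scope classical_set_scope.
Local Open Scope ring_scope.

Section Definitions.
Context {R : realType}.

(* Points of R^3 are row vectors.  MathComp-Analysis has no measurable structure
   on matrices, so measures live on R * R * R and are transported along [pt]. *)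
Notation E3 := 'rV[R]_3.

Definition pt (p : R * R * R) : E3 :=
  \row_i (if val i == 0%N then p.1.1 else if val i == 1%N then p.1.2 else p.2).

(* Volume integral: three-dimensional Lebesgue measure is the product measure. *)
Definition vol_int (B : set E3) (f : E3 -> R) : R :=
  \int[((@lebesgue_measure R \x @lebesgue_measure R) \x @lebesgue_measure R)%E]_(p
    in pt @^-1` B) f (pt p).

Definition time_int (t : R) (f : R -> R) : R :=
  \int[@lebesgue_measure R]_(s in `[0, t]) f s.

Definition surf_int (dA : {measure set (R * R * R) -> \bar R})
    (A : set E3) (f : E3 -> R) : R :=
  \int[dA]_(p in pt @^-1` A) f (pt p).

Definition pdx (i : 'I_3) (f : E3 -> R) (x : E3) : R := 'D_(delta_mx 0 i) f x.

Definition dx (i : 'I_3) (f : E3 -> R -> R) (x : E3) (t : R) : R :=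
  pdx i (fun y => f y t) x.

Definition dt (f : E3 -> R -> R) (x : E3) (t : R) : R := derive1 (f x) t.

Definition derivable_x (B : set E3) (i : 'I_3) (f : E3 -> R -> R) : Prop :=
  forall x t, B x -> 0 < t -> derivable (fun y => f y t) x (delta_mx 0 i).

Definition derivable_t (B : set E3) (f : E3 -> R -> R) : Prop :=
  forall x t, B x -> 0 < t -> derivable (f x) t 1.

Definition boundary (B : set E3) : set E3 := closure B `\` interior B.

Definition cont_on (A : set E3) (f : E3 -> R) : Prop := {within A, continuous f}.

Definition cont_cyl (A : set E3) (f : E3 -> R -> R) : Prop :=
  {within A `*` [set t : R | 0 <= t], continuous (fun p : E3 * R => f p.1 p.2)}.

(* f, defined on the open set B, has a continuous extension to its closure. *)
Definition ext_on (B : set E3) (f : E3 -> R) : Prop :=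
  exists g : E3 -> R, cont_on (closure B) g /\ (forall x, B x -> f x = g x).

(* f, defined on B x (0, oo), extends continuously to closure B x [0, oo). *)
Definition ext_cyl (B : set E3) (f : E3 -> R -> R) : Prop :=
  exists g : E3 -> R -> R, cont_cyl (closure B) g /\
    (forall x t, B x -> 0 < t -> f x t = g x t).

Definition C1_closure (B : set E3) (f : E3 -> R) : Prop :=
  cont_on (closure B) f /\
  forall i, (forall x, B x -> derivable f x (delta_mx 0 i)) /\ ext_on B (pdx i f).

(* nu is the outward unit normal to B at the boundary point x: up to an error
   o(|y - x|), the tangent plane at x separates B from the complement of its
   closure.  The norm `|y - x| is the maximum norm, which is equivalent to the
   Euclidean one; nu itself is a unit vector for the Euclidean norm. *)
Definition outward_unit_normal (B : set E3) (x nu : E3) : Prop :=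
  [/\ boundary B x, \sum_i nu 0 i ^+ 2 = 1 &
   forall e : R, 0 < e -> exists2 d : R, 0 < d &
     forall y : E3, `|y - x| < d ->
       (\sum_i (y - x) 0 i * nu 0 i < - e * `|y - x| -> B y) /\
       (e * `|y - x| < \sum_i (y - x) 0 i * nu 0 i -> ~ closure B y)].

(* A bounded domain to which the divergence theorem applies.  The surface element
   dA is a finite measure, n is the outward unit normal at dA-almost every point of
   the boundary (n has no meaning at edges and corners), and Gauss' formula holds
   for fields of class C^1 up to the boundary.  Gauss' formula determines the
   vector measure n dA on the boundary, hence, as |n| = 1, dA itself: there is no
   freedom in the choice of the surface measure. *)
Definition regular_region (B : set E3) (n : E3 -> E3)
    (dA : {finite_measure set (R * R * R)%type -> \bar R}) : Prop :=
  [/\ [/\ B !=set0, open B, connected B & bounded_set B],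
      forall i, measurable_fun (pt @^-1` boundary B) (fun p => n (pt p) 0 i),
      {ae dA, forall p, boundary B (pt p) -> outward_unit_normal B (pt p) (n (pt p))} &
      forall F : 'I_3 -> E3 -> R, (forall i, C1_closure B (F i)) ->
        vol_int B (fun x => \sum_i pdx i (F i) x) =
        surf_int dA (boundary B) (fun x => \sum_i F i x * n x 0 i)].

Definition lowest_eigenvalue (A : 'M[R]_3) : R := inf [set l : R | eigenvalue A l].

Definition greatest_eigenvalue (A : 'M[R]_3) : R := sup [set l : R | eigenvalue A l].

Definition quad (A : 'M[R]_3) (u v : 'I_3 -> R) : R :=
  \sum_i \sum_j A i j * u i * v j.

Definition positive_definite (B : set E3) (k : E3 -> 'M[R]_3) : Prop :=
  forall x, closure B x ->
    0 < lowest_eigenvalue (k x) /\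
    forall xi : 'I_3 -> R,
      lowest_eigenvalue (k x) * (\sum_i xi i * xi i) <= quad (k x) xi xi /\
      quad (k x) xi xi <= greatest_eigenvalue (k x) * (\sum_i xi i * xi i).

Record medium := Medium {
  cond : E3 -> 'M[R]_3;         (* k_ij *)
  capacity : E3 -> R;           (* a *)
  density : E3 -> R;            (* varrho *)
  tau_q : R;
  tau_T : R }.

Record data := Data {
  src : E3 -> R -> R;           (* r *)
  T_init : E3 -> R;
  q_init : 'I_3 -> E3 -> R;
  qdot_init : 'I_3 -> E3 -> R;
  T_bdry : E3 -> R -> R;        (* vartheta, on closure Sigma1 *)
  q_bdry : E3 -> R -> R }.      (* xi, on Sigma2 *)

Definition regular_medium (B : set E3) (m : medium) : Prop :=
  [/\ forall i j, cont_on (closure B) (fun x => cond m x i j),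
      forall x, closure B x -> (cond m x)^T = cond m x,
      cont_on (closure B) (capacity m),
      cont_on (closure B) (density m) &
      0 <= tau_q m /\ 0 <= tau_T m].

Definition smooth_data (B S1 S2 : set E3) (D : data) : Prop :=
  [/\ cont_cyl (closure B) (src D),
      C1_closure B (T_init D),
      forall i, cont_on (closure B) (q_init D i) /\ cont_on (closure B) (qdot_init D i),
      cont_cyl (closure S1) (T_bdry D) &
      cont_cyl S2 (q_bdry D)].

Definition zero_boundary_data (S1 S2 : set E3) (D : data) : Prop :=
  (forall x t, closure S1 x -> 0 <= t -> T_bdry D x t = 0) /\
  (forall x t, S2 x -> 0 <= t -> q_bdry D x t = 0).

(* C^{1,1}, including the mixed derivative T_{,jt} of the constitutive equation,
   with continuous extension up to the boundary and up to t = 0. *)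
Definition temp_regular (B : set E3) (T : E3 -> R -> R) : Prop :=
  [/\ cont_cyl (closure B) T,
      derivable_t B T /\ ext_cyl B (dt T),
      forall i, derivable_x B i T /\ ext_cyl B (dx i T) &
      forall i, derivable_t B (dx i T) /\ ext_cyl B (dt (dx i T))].

(* C^{1,2}, with continuous extension up to the boundary and up to t = 0. *)
Definition flux_regular (B : set E3) (q : 'I_3 -> E3 -> R -> R) : Prop :=
  forall i,
  [/\ cont_cyl (closure B) (q i),
      derivable_t B (q i) /\ ext_cyl B (dt (q i)),
      derivable_t B (dt (q i)) /\ ext_cyl B (dt (dt (q i))) &
      forall j, derivable_x B j (q i) /\ ext_cyl B (dx j (q i))].

Definition constitutive_eq (B : set E3) (m : medium)
    (T : E3 -> R -> R) (q : 'I_3 -> E3 -> R -> R) : Prop :=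
  forall (i : 'I_3) x t, B x -> 0 < t ->
    q i x t + tau_q m * dt (q i) x t + 2^-1 * tau_q m ^+ 2 * dt (dt (q i)) x t =
    - (\sum_j cond m x i j * dx j T x t)
    - tau_T m * (\sum_j cond m x i j * dt (dx j T) x t).

Definition energy_eq (B : set E3) (m : medium) (r : E3 -> R -> R)
    (T : E3 -> R -> R) (q : 'I_3 -> E3 -> R -> R) : Prop :=
  forall x t, B x -> 0 < t ->
    - (\sum_i dx i (q i) x t) + density m x * r x t = capacity m x * dt T x t.

(* The time derivative at t = 0 is one-sided, as fields live on [0, oo). *)
Definition initial_conditions (B : set E3) (D : data)
    (T : E3 -> R -> R) (q : 'I_3 -> E3 -> R -> R) : Prop :=
  forall x, closure B x ->
    [/\ T x 0 = T_init D x,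
        forall i, q i x 0 = q_init D i x &
        forall i, h^-1 * (q i x h - q i x 0) @[h --> 0^'+] --> qdot_init D i x].

(* The flux condition is imposed wherever the outward normal exists. *)
Definition boundary_conditions (B : set E3) (n : E3 -> E3) (S1 S2 : set E3) (D : data)
    (T : E3 -> R -> R) (q : 'I_3 -> E3 -> R -> R) : Prop :=
  (forall x t, closure S1 x -> 0 <= t -> T x t = T_bdry D x t) /\
  (forall x t, S2 x -> outward_unit_normal B x (n x) -> 0 <= t ->
     \sum_i q i x t * n x 0 i = q_bdry D x t).

Definition solution (B : set E3) (n : E3 -> E3) (S1 S2 : set E3) (m : medium) (D : data)
    (T : E3 -> R -> R) (q : 'I_3 -> E3 -> R -> R) : Prop :=
  [/\ temp_regular B T /\ flux_regular B q,
      constitutive_eq B m T q,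
      energy_eq B m (src D) T q,
      initial_conditions B D T q &
      boundary_conditions B n S1 S2 D T q].

(* Time integration, written with a prime in the formulas: h'(t) = int_0^t h. *)
Definition prim (h : R -> R) (t : R) : R := time_int t h.

Definition tilde (tauT : R) (h : R -> R) (t : R) : R := prim h t + tauT * h t.

Definition resist (m : medium) (x : E3) : 'M[R]_3 := invmx (cond m x).

Definition K_low (m : medium) (x : E3) : R := lowest_eigenvalue (resist m x).

Definition Rstar (m : medium) (D : data) (x : E3) (t : R) : R :=
  density m x * tilde (tau_T m) (src D x) t + capacity m x * T_init D x.

Definition phi (m : medium) (D : data) (i : 'I_3) (x : E3) : R :=
  tau_T m * pdx i (T_init D) x +
  \sum_j resist m x i j *
    (tau_q m * q_init D j x + 2^-1 * tau_q m ^+ 2 * qdot_init D j x).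

Definition phi2 (m : medium) (D : data) (x : E3) : R :=
  \sum_i phi m D i x * phi m D i x.

Definition Kqq (m : medium) (x : E3) (v : 'I_3 -> R) : R := quad (resist m x) v v.

Definition calE (B : set E3) (m : medium)
    (T : E3 -> R -> R) (q : 'I_3 -> E3 -> R -> R) (t : R) : R :=
  2^-1 * time_int t (fun s =>
    vol_int B (fun x => capacity m x * tilde (tau_T m) (T x) s ^+ 2)) +
  2^-1 * time_int t (fun s => time_int s (fun z =>
    vol_int B (fun x => Kqq m x (fun i => prim (q i x) z)))).

Definition calF (B : set E3) (m : medium)
    (T : E3 -> R -> R) (q : 'I_3 -> E3 -> R -> R) (t : R) : R :=
  calE B m T q t +
  4^-1 * tau_T m * tau_q m ^+ 2 *
    time_int t (fun s => vol_int B (fun x => Kqq m x (fun i => q i x s))).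

Definition gfun (B : set E3) (m : medium) (D : data) (t : R) : R :=
  Num.sqrt (time_int t (fun s =>
    vol_int B (fun x => (capacity m x)^-1 * Rstar m D x s ^+ 2))).

Definition data_bound (B : set E3) (m : medium) (D : data) (T : E3 -> R -> R) (S : R) : R :=
  Num.sqrt
   (S / 2 * vol_int B (fun x =>
       capacity m x * tilde (tau_T m) (T x) 0 ^+ 2
       + 2^-1 * tau_T m * tau_q m ^+ 2 * Kqq m x (fun i => q_init D i x)
       + tau_T m / K_low m x * phi2 m D x)
    + S ^+ 2 / 4 * vol_int B (fun x => (K_low m x)^-1 * phi2 m D x)).

Definition sigma2 (m : medium) : R := (tau_T m)^-1 - 2 / tau_q m.

End Definitions.

Arguments medium R : clear implicits.
Arguments data R : clear implicits.

(* Main.v *)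
Require Import Defs.
From HB Require Import structures.
From mathcomp Require Import all_boot all_order all_algebra.
From mathcomp Require Import all_classical all_reals all_analysis.
From mathcomp Require Import ring lra.

Set Implicit Arguments.
Unset Strict Implicit.
Unset Printing Implicit Defensive.

Import Order.TTheory GRing.Theory Num.Theory.
Import numFieldNormedType.Exports.

Local Open Scope classical_set_scope.
Local Open Scope ring_scope.

(** The system is integrated in time until only the data are left besides the
    unknowns, and an energy identity for the integrated system is combined with
    a quadratic Gronwall inequality.

    Let p be the time integral of q, and v the time derivative of q.  One time
    integration of the constitutive equation gives
<<
      grad Tt = phi - K (p + tau_q q + tau_q^2/2 v)     (gradient_tilde),
>>
    where Tt is the tilde of T, and the energy equation, integrated once and
    added to tau_T times itself, gives
<<
      a dTt/dt = - div qt + Rstar                        (integrated_energy),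
>>
    where qt = p + tau_T q.  All the initial values sit in phi and Rstar.  The
    second equation is multiplied by Tt and integrated over B.  The boundary
    conditions make the flux of Tt qt through the boundary vanish, so that the
    divergence theorem moves the divergence onto Tt, where the first equation
    applies (divergence_work, work_balance).  Since q = dp/dt, v = dq/dt and K
    is symmetric, most of the products are time derivatives
    (energy_balance):
<<
      d/dt [ 1/2 int a Tt^2 + (tau_q + tau_T)/2 int K p p + tau_q^2/2 int K q p
             + tau_T tau_q^2/4 int K q q - tau_T int phi p ]
        = - int K p p + tau_q (tau_q/2 - tau_T) int K q q
          + int Tt Rstar + int phi p.
>>
    The term int K q p has no sign, but it is half the time derivative of
    int K p p, so that it becomes nonnegative after one more time integration;
    this is why the energy of the statement consists of repeated time integrals.
    The products phi p are absorbed by Young's inequality for the pair of forms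
    K and k, at the cost of 1/K_m, which is the greatest eigenvalue of k
    (quad_young, lowest_eigenvalue_invmx).  The product Tt Rstar is bounded by
    the Cauchy-Schwarz inequality in space and time (weighted_young_sqrt).  When
    2 tau_T < tau_q the term with int K q q has the wrong sign, but its
    coefficient is 2 sigma^2 times the one with which int K q q enters F.  With
    F = E in the other case, both cases lead to
<<
      F(t) <= M + sqrt 2 int_0^t g sqrt F + 2 b int_0^t F
>>
    with b = 0 or b = sigma^2, and gronwall_sqrt concludes.

    A solution has derivatives in B x (0, oo) only, which extend continuously to
    the closure of B and to time 0.  The analysis below is therefore carried out
    for functions continuous on the closed cylinder.  Its main tool is the tube
    lemma (tube): as the closure of B, or a time interval, is compact, continuity
    in one of the variables is uniform in the other one.  This yields
    differentiation under the volume integral (antideriv_vol_int) and under the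
    time integral (is_derive_space_prim). *)

(** * Continuity within a set *)

Section ContinuityWithin.
Context {R : realType} {X : topologicalType} (A : set X).
Implicit Types f g : X -> R.

Lemma within_continuous_cst (c : R) : {within A, continuous (fun=> c)}.
Proof. by move=> x; exact: cvg_cst. Qed.

Lemma within_continuousD f g : {within A, continuous f} ->
  {within A, continuous g} -> {within A, continuous (fun x => f x + g x)}.
Proof. by move=> cf cg x; apply: cvgD; [exact: cf|exact: cg]. Qed.

Lemma within_continuousB f g : {within A, continuous f} ->
  {within A, continuous g} -> {within A, continuous (fun x => f x - g x)}.
Proof. by move=> cf cg x; apply: cvgB; [exact: cf|exact: cg]. Qed.

Lemma within_continuousM f g : {within A, continuous f} ->
  {within A, continuous g} -> {within A, continuous (fun x => f x * g x)}.
Proof. by move=> cf cg x; apply: cvgM; [exact: cf|exact: cg]. Qed.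

Lemma within_continuous_fun (h : R -> R) f : continuous h ->
  {within A, continuous f} -> {within A, continuous (fun x => h (f x))}.
Proof.
by move=> ch cf x; apply: (@cvg_comp _ _ _ f h _ (nbhs (f x))); [exact: cf|exact: ch].
Qed.

Lemma within_continuousX f k : {within A, continuous f} ->
  {within A, continuous (fun x => f x ^+ k)}.
Proof. by apply: (@within_continuous_fun (fun y => y ^+ k)); exact: exprn_continuous. Qed.

Lemma within_continuousV f : (forall x, A x -> f x != 0) ->
  {within A, continuous f} -> {within A, continuous (fun x => (f x)^-1)}.
Proof.
move=> f0 /subspace_continuousP cf; apply/subspace_continuousP => x Ax.
by apply: cvgV; [exact: f0|exact: cf].
Qed.

Lemma within_continuous_sum (I : Type) (r : seq I) (P : pred I) (F : I -> X -> R) :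
  (forall i, {within A, continuous (F i)}) ->
  {within A, continuous (fun x => \sum_(i <- r | P i) F i x)}.
Proof.
move=> cF; have -> : (fun x => \sum_(i <- r | P i) F i x) = \sum_(i <- r | P i) F i.
  by apply/funext => x; rewrite fct_sumE.
elim/big_ind : _ => //; first exact: within_continuous_cst.
exact: within_continuousD.
Qed.

Lemma within_continuous_prod (I : Type) (r : seq I) (P : pred I) (F : I -> X -> R) :
  (forall i, {within A, continuous (F i)}) ->
  {within A, continuous (fun x => \prod_(i <- r | P i) F i x)}.
Proof.
move=> cF; elim: r => [|i r IH].
  by under eq_fun do rewrite big_nil; exact: within_continuous_cst.
under eq_fun do rewrite big_cons; case: (P i) => //.
exact: within_continuousM.
Qed.

Lemma eq_within_continuous f g : (forall x, A x -> f x = g x) ->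
  {within A, continuous f} -> {within A, continuous g}.
Proof.
by move=> fg; apply: subspace_eq_continuous => x /set_mem; exact: fg.
Qed.

End ContinuityWithin.

Lemma within_continuous_sub (R : realType) (X Y : topologicalType) (A : set X)
    (B : set Y) (h : Y -> X) (f : X -> R) :
  continuous h -> (forall y, B y -> A (h y)) ->
  {within A, continuous f} -> {within B, continuous (fun y => f (h y))}.
Proof.
move=> ch BA /subspace_continuousP cf; apply/subspace_continuousP => y By.
apply: (@cvg_comp _ _ _ h f _ (within A (nbhs (h y)))); last exact/cf/BA.
move=> U /= AU; have := ch y _ AU; rewrite /nbhs /= /within /=.
by apply: filterS => z + Bz; apply; exact: BA.
Qed.

Section Tube.
Context {R : realType} {X Y : topologicalType} (C : set X) (Z : set Y).

(** Compactness of [C] makes the modulus of continuity at [y0] independent of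
    the point of [C]. *)
Lemma tube (f : X -> Y -> R) (y0 : Y) (e : R) : compact C -> Z y0 -> 0 < e ->
  {within C `*` Z, continuous (fun p => f p.1 p.2)} ->
  \forall y \near y0, Z y -> forall x, C x -> `|f x y - f x y0| < e.
Proof.
move=> cC Zy0 e0 /subspace_continuousP cf.
have /near_covering_withinP cov := (compact_near_coveringP C).1 cC.
have H : \forall y \near y0, C `<=` (fun x => Z y -> `|f x y - f x y0| < e).
  apply: cov => x Cx.
  have [[P Q] /= [Px Qy] PQ] : nbhs (x, y0)
      [set p : X * Y | C p.1 /\ Z p.2 -> `|f x y0 - f p.1 p.2| < e / 2].
    have e2 : 0 < e / 2 by rewrite divr_gt0.
    have /= := cf (x, y0) (conj Cx Zy0) _ (nbhsx_ballx _ _ e2).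
    by rewrite nbhs_simpl /= /within /=.
  exists (P, Q) => //= -[x' y] /= [Px' Qy'] Cx' Zy.
  have h1 := PQ (x', y) (conj Px' Qy') (conj Cx' Zy).
  have h2 := PQ (x', y0) (conj Px' (nbhs_singleton Qy)) (conj Cx' Zy0).
  rewrite /= in h1 h2.
  have -> : f x' y - f x' y0 = (f x y0 - f x' y0) - (f x y0 - f x' y) by ring.
  apply: (le_lt_trans (ler_normB _ _)); rewrite (splitr e).
  exact: ltrD.
by apply: filterS H => y H Zy x Cx; exact: H.
Qed.
End Tube.

Section IsDeriveEps.
Context {R : realType} {V : normedModType R}.

(** The error term [e * `|h|] is the form in which the mean value theorem, and
    the integration of its conclusions in time or space, produce derivatives. *)
Lemma is_derive_eps (F : V -> R) (x v : V) (d : R) :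
  (forall e, 0 < e -> \forall h \near (0 : R), `|F (h *: v + x) - F x - h * d| <= e * `|h|) ->
  is_derive x v F d.
Proof.
move=> H.
have cv : h^-1 *: ((F \o shift x) (h *: v) - F x) @[h --> (0:R)^'] --> d.
  apply/cvgrPdist_le => e e0.
  have He := H _ e0.
  have He' : \forall h \near (0:R)^', `|F (h *: v + x) - F x - h * d| <= e * `|h|.
    exact: nbhs_dnbhs.
  near=> h.
  have h0 : h != 0 by near: h; exact: nbhs_dnbhs_neq.
  have hn : 0 < `|h| by rewrite normr_gt0.
  rewrite /= -(ler_pM2r hn).
  have -> : `|d - h^-1 *: (F (h *: v + x) - F x)| * `|h| = `|F (h *: v + x) - F x - h * d|.
    rewrite -normrM distrC; congr `|_|; set z := F _ - F x.
    by rewrite (_ : h^-1 *: z = h^-1 * z) //; field.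
  by near: h.
by split; [apply/cvg_ex; exists d|apply/cvg_lim].
Unshelve. all: by end_near. Qed.

(** Reduces a directional derivative to a derivative of a function of one
    variable, for which there is a mean value theorem. *)
Lemma is_derive_line (g : V -> R) (x v : V) (a d : R) :
  is_derive (a *: v + x) v g d -> is_derive a 1 (fun b => g (b *: v + x)) d.
Proof.
have E : (fun h : R => h^-1 *: (((fun b => g (b *: v + x)) \o shift a) (h *: 1)
            - g (a *: v + x))) =
         (fun h : R => h^-1 *: ((g \o shift (a *: v + x)) (h *: v) - g (a *: v + x))).
  apply/funext => h /=; congr (_ *: (g _ - _)).
  by rewrite (_ : h *: 1 = h :> R) ?scalerDl ?addrA // /GRing.scale /= mulr1.
by move=> [dg gd]; split; rewrite /derivable /derive E.
Qed.

Lemma line_cvg (v x : V) :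
  (fun a : R => a *: v + x) @ (0 : R) --> x.
Proof.
have : (fun a : R => a *: v + x) @ (0 : R) --> 0 *: v + x.
  by apply: cvgD; [apply: cvgZ; [exact: cvg_id|exact: cvg_cst]|exact: cvg_cst].
by rewrite scale0r add0r.
Qed.

End IsDeriveEps.

(** * Calculus on the half-line of times *)

(** The increment of [F] is [h] times [dF] at an intermediate point, so the
    oscillation of [dF] bounds the error of the linear approximation. *)
Lemma mvt_increment (R : realType) (F dF : R -> R) (t h e : R) :
  (forall s, `|s - t| <= `|h| -> is_derive s 1 F (dF s)) ->
  (forall s, `|s - t| <= `|h| -> `|dF s - dF t| <= e) ->
  `|F (h + t) - F t - h * dF t| <= e * `|h|.
Proof.
move=> dFs dFe.
have cF a b : (forall s, a <= s <= b -> `|s - t| <= `|h|) -> {within `[a, b], continuous F}.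
  move=> ab; apply: derivable_within_continuous => s; rewrite in_itv /= => sab.
  by have := dFs s (ab s sab) => -[dF1 _].
have [h0|h0] := leP 0 h.
  have th : t <= h + t by rewrite lerDr.
  have near_t s : t <= s <= h + t -> `|s - t| <= `|h|.
    by move=> /andP[ts st]; rewrite !ger0_norm ?subr_ge0 // lerBlDr.
  have [|c cab ->] := @MVT_segment R F dF _ _ th _ (cF _ _ near_t).
    by move=> c; rewrite in_itv /= => /andP[/ltW c1 /ltW c2]; apply/dFs/near_t; rewrite c1.
  rewrite addrK mulrC -mulrBr normrM mulrC ler_wpM2r // dFe // near_t //.
have th : h + t <= t by rewrite gerDr ltW.
have near_t s : h + t <= s <= t -> `|s - t| <= `|h|.
  move=> /andP[ts st]; rewrite !ler0_norm ?subr_le0 ?(ltW h0) // opprB.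
  by rewrite lerBlDr addrC lerBrDr addrC.
have [|c cab E] := @MVT_segment R F dF _ _ th _ (cF _ _ near_t).
  by move=> c; rewrite in_itv /= => /andP[/ltW c1 /ltW c2]; apply/dFs/near_t; rewrite c1.
rewrite -(opprB (F t)) E.
have -> : - (dF c * (t - (h + t))) - h * dF t = h * (dF c - dF t) by ring.
by rewrite normrM mulrC ler_wpM2r // dFe // near_t.
Qed.

Lemma is_derive_sqrt (R : realType) (y : R) : 0 < y ->
  is_derive y 1 (@Num.sqrt R) (2 * Num.sqrt y)^-1.
Proof.
move=> y0; have sy : 0 < Num.sqrt y by rewrite sqrtr_gt0.
rewrite -[y in is_derive y](sqr_sqrtr (ltW y0)).
apply: (@is_derive_inverse R (fun x => x ^+ 2) Num.sqrt _ (Num.sqrt y)).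
- near=> x; rewrite sqrtr_sqr ger0_norm //; apply: ltW; near: x; exact: lt_nbhsr.
- by near=> x; exact: exprn_continuous.
- by apply: is_derive_eq; rewrite /GRing.scale /= mulr1 mulr_natl.
- by rewrite mulf_neq0 // gt_eqF.
Unshelve. all: by end_near. Qed.

(** The fields live on [0, oo), and their values at negative times are
    arbitrary.  Hence the derivative is only required at positive times, with
    continuity at 0 from the right. *)
Definition antideriv (R : realType) (U u : R -> R) : Prop :=
  {within [set t : R | 0 <= t], continuous U} /\
  forall t : R, 0 < t -> is_derive t 1 U (u t).

Section OneVariable.
Context {R : realType}.
Implicit Types U V u v h : R -> R.
Notation half := [set t : R | 0 <= t].
Notation continuous_half h := {within [set t : R | 0 <= t], continuous h}.

(** The mean value theorem asks only for the existence of the derivatives, so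
    [u] and [v] may be, for instance, the second time derivatives of the
    fluxes. *)
Lemma antideriv_le U u V v : antideriv U u -> antideriv V v ->
  forall t, 0 <= t -> (forall s, 0 < s < t -> u s <= v s) ->
  U t - U 0 <= V t - V 0.
Proof.
move=> [cU dU] [cV dV] t + uv; rewrite le_eqVlt => /predU1P[<-|t0].
  by rewrite !subrr.
have [||c] := @MVT R (fun s => V s - U s) (fun s => v s - u s) 0 t t0.
- move=> s; rewrite in_itv /= => /andP[s0 _].
  by have := dV s s0; have := dU s s0 => ? ?; exact: is_deriveB.
- apply: continuous_subspaceW (within_continuousB cV cU) => s /=.
  by rewrite in_itv /= => /andP[].
rewrite in_itv /= subr0 => cab; move: (cab) => /andP[c0 _].
have : 0 <= (v c - u c) * t by rewrite mulr_ge0 ?subr_ge0 ?uv // ltW.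
lra.
Qed.

Lemma antideriv_unique U V u v : antideriv U u -> antideriv V v ->
  forall t, 0 <= t -> (forall s, 0 < s < t -> u s = v s) ->
  U t - U 0 = V t - V 0.
Proof.
move=> aU aV t t0 uv; apply/eqP; rewrite eq_le.
by rewrite (antideriv_le aU aV) ?(antideriv_le aV aU) // => s s0; rewrite uv.
Qed.

Lemma eq_antideriv U V u v : antideriv U u -> (forall t, 0 <= t -> U t = V t) ->
  (forall t, 0 < t -> u t = v t) -> antideriv V v.
Proof.
move=> [cU dU] UV uv; split; first exact: eq_within_continuous cU.
move=> t t0; rewrite -uv //; apply: near_eq_is_derive (dU t t0).
near=> s; apply: UV; apply: ltW; near: s; exact: lt_nbhsr.
Unshelve. all: by end_near. Qed.

Lemma antideriv_cst (c : R) : antideriv (fun=> c) (fun=> 0).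
Proof. by split=> [|t _]; [exact: within_continuous_cst|exact: is_derive_cst]. Qed.

Lemma antideriv_id : antideriv id (fun=> 1 : R).
Proof.
split=> [|t _]; last exact: is_derive_id.
by apply: continuous_subspaceT => x; exact: cvg_id.
Qed.

Lemma antiderivD U u V v : antideriv U u -> antideriv V v ->
  antideriv (fun t => U t + V t) (fun t => u t + v t).
Proof.
move=> [cU dU] [cV dV]; split; first exact: within_continuousD.
by move=> t t0; have := dU t t0; have := dV t t0 => ? ?; exact: is_deriveD.
Qed.

Lemma antiderivM U u V v : antideriv U u -> antideriv V v ->
  antideriv (fun t => U t * V t) (fun t => u t * V t + U t * v t).
Proof.
move=> [cU dU] [cV dV]; split; first exact: within_continuousM.
move=> t t0; have := dU t t0; have := dV t t0 => ? ?.
by apply: is_derive_eq; rewrite /GRing.scale /= addrC mulrC.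
Qed.

Lemma antiderivZ (c : R) U u : antideriv U u ->
  antideriv (fun t => c * U t) (fun t => c * u t).
Proof.
move=> aU; apply: (eq_antideriv (antiderivM (antideriv_cst c) aU)) => // t _.
by rewrite mul0r add0r.
Qed.

Lemma antiderivB U u V v : antideriv U u -> antideriv V v ->
  antideriv (fun t => U t - V t) (fun t => u t - v t).
Proof.
move=> aU aV; apply: (eq_antideriv (antiderivD aU (antiderivZ (-1) aV))) => t _;
  by rewrite mulN1r.
Qed.

Lemma antideriv_sum n (U u : 'I_n -> R -> R) :
  (forall i, antideriv (U i) (u i)) ->
  antideriv (fun t => \sum_i U i t) (fun t => \sum_i u i t).
Proof.
move=> aU; split=> [|t t0]; first by apply: within_continuous_sum => i; case: (aU i).
have -> : (fun t => \sum_i U i t) = \sum_i U i by apply/funext => s; rewrite fct_sumE.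
by have := fun i => (aU i).2 t t0 => ?; exact: is_derive_sum.
Qed.

Lemma prim0 h : prim h 0 = 0.
Proof. by rewrite /prim /time_int set_itv1 Rintegral_set1. Qed.

Lemma half_integrable h t : continuous_half h ->
  (@lebesgue_measure R).-integrable `[0, t] (EFin \o h).
Proof.
move=> ch; apply: continuous_compact_integrable; first exact: segment_compact.
by apply: continuous_subspaceW ch => s /=; rewrite in_itv /= => /andP[].
Qed.

(** Continuity is local, so results on compact intervals apply to the
    half-line. *)
Lemma within_half_line (t : R) : 0 <= t ->
  within half (nbhs t) = within `[0, t + 1]%classic (nbhs t).
Proof.
move=> t0; apply/seteqP; split=> A; rewrite /within /=.
  apply: filterS => s + /[!in_itv] /= /andP[s0 _]; exact.
move=> H; near=> s => s0; have : `[0, t + 1]%classic s -> A s by near: s.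
apply; rewrite /= in_itv /= s0 /=; near: s.
by apply: lt_le_nbhsl; rewrite ltrDl.
Unshelve. all: by end_near. Qed.

Lemma antideriv_prim h : continuous_half h -> antideriv (prim h) h.
Proof.
move=> ch; split=> [|t t0].
  apply/subspace_continuousP => t /= t0; rewrite within_half_line //.
  have t1 : 0 <= t + 1 by rewrite addr_ge0.
  have := parameterized_integral_continuous t1 (half_integrable (t + 1) ch).
  move/subspace_continuousP; apply => /=.
  by rewrite in_itv /= t0 lerDl ler01.
have := @continuous_FTC1_closed R h 0 t (t + 1) _ (half_integrable (t + 1) ch) t0.
have -> : t < t + 1 by rewrite ltrDl.
move=> /(_ isT) []; last by rewrite derive1E => dF Fh; split.
move/subspace_continuousP : ch => /(_ t (ltW t0)) /=.
suff -> : within half (nbhs t) = nbhs t by [].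
apply/seteqP; split=> A; last by rewrite /within /=; apply: filterS.
rewrite /within /= => H; near=> s; have : half s -> A s by near: s.
apply => /=; apply: ltW; near: s; exact: lt_nbhsr.
Unshelve. all: by end_near. Qed.

Lemma prim_unique U u : antideriv U u -> continuous_half u ->
  forall t, 0 <= t -> prim u t = U t - U 0.
Proof.
move=> aU cu t t0; rewrite -(antideriv_unique (antideriv_prim cu) aU) //.
by rewrite prim0 subr0.
Qed.

Lemma continuous_half_prim h : continuous_half h -> continuous_half (prim h).
Proof. by move=> /antideriv_prim []. Qed.

Lemma prim_le h k t : continuous_half h -> continuous_half k -> 0 <= t ->
  (forall s, 0 < s < t -> h s <= k s) -> prim h t <= prim k t.
Proof.
move=> ch ck t0 hk.
by have := antideriv_le (antideriv_prim ch) (antideriv_prim ck) t0 hk; rewrite !prim0 !subr0.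
Qed.

Lemma eq_prim h k t : (forall s, 0 <= s <= t -> h s = k s) -> prim h t = prim k t.
Proof.
move=> hk; apply: eq_Rintegral => s /set_mem /=; rewrite in_itv /=; exact: hk.
Qed.

Lemma antideriv_norm_le (U u : R -> R) (c t : R) : antideriv U u -> 0 <= t ->
  (forall s, 0 < s < t -> `|u s| <= c) -> `|U t - U 0| <= c * t.
Proof.
move=> aU t0 uc; have aV := antiderivZ c antideriv_id.
have uc' s : 0 < s < t -> - c <= u s <= c by move=> /uc; rewrite ler_norml.
rewrite ler_norml; apply/andP; split.
  have := antideriv_le (antiderivZ (-1) aV) aU t0 _.
  by rewrite /= !mulr0 subr0 !mulN1r mulr1; apply => s /uc' /andP[].
have := antideriv_le aU aV t0 _; rewrite /= mulr0 subr0; apply => s /uc' /andP[_].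
by rewrite mulr1.
Qed.

Lemma continuous_half_le0 (u : R -> R) (c t : R) : continuous_half u -> 0 < t ->
  (forall s, 0 < s <= t -> u s <= c) -> u 0 <= c.
Proof.
move=> /subspace_continuousP cu t0 uc; apply/ler_addgt0Pr => e e0.
have /cvgrPdist_lt/(_ e e0) := cu 0 (lexx 0).
rewrite near_withinE => /nbhs_ballP[d /= d0 Hd].
pose s := Num.min (d / 2) t.
have s0 : 0 < s by rewrite lt_min t0 divr_gt0.
have sd : s < d by rewrite gt_min; apply/orP; left; rewrite ltr_pdivrMr // ltr_pMr // ltr1n.
have : `|u 0 - u s| < e.
  by apply: Hd; rewrite /= ?(ltW s0) // -ball_normE /ball_ /= sub0r normrN gtr0_norm.
have : u s <= c by apply: uc; rewrite s0 ge_min lexx orbT.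
rewrite ltr_norml => ? /andP[_]; lra.
Qed.

(** By the mean value theorem the difference quotients at 0 are values of [u]
    at small positive times. *)
Lemma antideriv_right_derivative (U u : R -> R) (d : R) :
  antideriv U u -> continuous_half u ->
  h^-1 * (U h - U 0) @[h --> 0^'+] --> d -> u 0 = d.
Proof.
move=> aU cu Ud.
have Uu0 : h^-1 * (U h - U 0) @[h --> 0^'+] --> u 0.
  apply/cvgrPdist_le => e e0.
  have /subspace_continuousP/(_ 0 (lexx 0))/cvgrPdist_le/(_ e e0) := cu.
  rewrite near_withinE => /nbhs_ballP[r /= r0 Hr].
  near=> h.
  have h0 : 0 < h by near: h; exact: nbhs_right_gt.
  have hr : h < r by near: h; exact: nbhs_right_lt.
  have := antideriv_norm_le (c := e)
    (antiderivB aU (antiderivZ (u 0) antideriv_id)) (ltW h0) _.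
  rewrite /= mulr0 subr0 mulr1 => H.
  have {}H : `|U h - u 0 * h - U 0| <= e * h.
    apply: H => s /andP[s0 sh]; rewrite distrC; apply: Hr; last exact: ltW.
    by rewrite -ball_normE /ball_ /= sub0r normrN gtr0_norm // (lt_trans sh).
  rewrite -(ler_pM2r h0) -[X in _ * X <= _](gtr0_norm h0) -normrM.
  have -> : (u 0 - h^-1 * (U h - U 0)) * h = - (U h - u 0 * h - U 0).
    by field; rewrite gt_eqF.
  by rewrite normrN.
exact: (cvg_unique (@norm_hausdorff _ _) Uu0 Ud).
Unshelve. all: by end_near. Qed.

Lemma primZ (c : R) h t : continuous_half h -> 0 <= t ->
  prim (fun s => c * h s) t = c * prim h t.
Proof.
move=> ch t0; rewrite (prim_unique (antiderivZ c (antideriv_prim ch))) //.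
  by rewrite prim0 mulr0 subr0.
by apply: within_continuousM => //; exact: within_continuous_cst.
Qed.

Lemma prim_ge0 (h : R -> R) (t : R) : (forall s, 0 <= s -> 0 <= h s) -> 0 <= prim h t.
Proof.
by move=> h0; apply: Rintegral_ge0 => s; rewrite /= in_itv /= => /andP[s0 _]; exact: h0.
Qed.

End OneVariable.

(** * The quadratic Gronwall inequality *)

Section Gronwall.
Context {R : realType}.
Implicit Types F g : R -> R.
Notation continuous_half h := {within [set t : R | 0 <= t], continuous h}.

(** The square root of the right-hand side of the hypothesis satisfies a linear
    differential inequality, which is integrated with the factor
    [expR (- b * t)]. *)
Lemma gronwall_sqrt F g (M b S : R) :
  continuous_half F -> continuous_half g ->
  (forall t, 0 <= t -> 0 <= F t) -> (forall t, 0 <= t -> 0 <= g t) ->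
  0 <= M -> 0 <= b ->
  (forall t, 0 <= t <= S ->
    F t <= M + Num.sqrt 2 * prim (fun s => g s * Num.sqrt (F s)) t + 2 * b * prim F t) ->
  forall t, 0 <= t <= S ->
    Num.sqrt (F t) <= (Num.sqrt 2)^-1 * prim (fun s => expR (b * (t - s)) * g s) t
      + expR (b * t) * Num.sqrt M.
Proof.
move=> cF cg F0 g0 M0 b0 Fle t /andP[t0 tS].
have cgF : continuous_half (fun s => g s * Num.sqrt (F s)).
  exact: (within_continuousM cg (within_continuous_fun (@sqrt_continuous R) cF)).
have cexp : continuous_half (fun s => expR (- b * s)).
  apply: continuous_subspaceT => x; apply: continuous_comp; last exact: continuous_expR.
  exact: mulrl_continuous.
have cge : continuous_half (fun s => expR (- b * s) * g s) by exact: within_continuousM.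
have s2 : 0 < Num.sqrt 2 :> R by rewrite sqrtr_gt0.
apply/ler_addgt0Pr => e e0.
(* [eta ^+ 2] keeps the square root of [Y] away from its singularity at 0. *)
pose eta := e / expR (b * t).
have eta0 : 0 < eta by rewrite divr_gt0 ?expR_gt0.
pose Y s := (M + eta ^+ 2) +
  (Num.sqrt 2 * prim (fun s => g s * Num.sqrt (F s)) s + 2 * b * prim F s).
have aY : antideriv Y (fun s => Num.sqrt 2 * (g s * Num.sqrt (F s)) + 2 * b * F s).
  apply: (eq_antideriv (antiderivD (antideriv_cst (M + eta ^+ 2)) (antiderivD
    (antiderivZ (Num.sqrt 2) (antideriv_prim cgF))
    (antiderivZ (2 * b) (antideriv_prim cF))))) => // s _.
  by rewrite add0r.
have Ypos s : 0 <= s -> 0 < Y s.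
  move=> s0; rewrite /Y ltr_wpDr //; last by rewrite ltr_wpDl // exprn_gt0.
  rewrite addr_ge0 // mulr_ge0 ?(ltW s2) ?mulr_ge0 //.
    by apply: prim_ge0 => z z0; rewrite mulr_ge0 ?g0 ?sqrtr_ge0.
  exact: prim_ge0.
have FY s : 0 <= s <= S -> Num.sqrt (F s) <= Num.sqrt (Y s).
  move=> sS; rewrite ler_sqrt; last by apply: ltW; apply: Ypos; case/andP: sS.
  apply: (le_trans (Fle s sS)); rewrite /Y.
  by have := sqr_ge0 eta; lra.
(* [2 b Y] in the derivative of [Y] is compensated by the integrating factor. *)
pose w s := expR (- b * s) * Num.sqrt (Y s).
pose dw s := expR (- b * s) * (- b * Num.sqrt (Y s) +
  (Num.sqrt 2 * (g s * Num.sqrt (F s)) + 2 * b * F s) / (2 * Num.sqrt (Y s))).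
have aw : antideriv w dw.
  split.
    exact: (within_continuousM cexp (within_continuous_fun (@sqrt_continuous R) aY.1)).
  move=> s s0; have dY := aY.2 s s0.
  have dS := is_derive_sqrt (Ypos s (ltW s0)).
  have dsY : is_derive s 1 (Num.sqrt \o Y) _ := is_derive1_comp dS dY.
  apply: is_derive_eq.
  rewrite /dw /GRing.scale /=.
  by set i := (2 * Num.sqrt (Y s))^-1; ring.
have wle := antideriv_le aw (antiderivZ (Num.sqrt 2)^-1 (antideriv_prim cge)) t0.
have {}wle : w t - w 0 <= (Num.sqrt 2)^-1 * prim (fun s => expR (- b * s) * g s) t.
  have := wle _; rewrite prim0 mulr0 subr0; apply => s /andP[s0 st].
  have sS : 0 <= s <= S by rewrite (ltW s0) (le_trans (ltW st)).
  have yp : 0 < Num.sqrt (Y s) by rewrite sqrtr_gt0 Ypos // ltW.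
  rewrite /dw (mulrCA _ (expR _)) ler_pM2l ?expR_gt0 //.
  rewrite addrC mulNr lerBlDr ler_pdivrMr ?mulr_gt0 //.
  have -> : (Num.sqrt 2)^-1 = Num.sqrt 2 / 2 :> R.
    by rewrite -{3}(sqr_sqrtr (ler0n R 2)) expr2 invfM mulVKf // gt_eqF.
  have Fsq := sqr_sqrtr (F0 s (ltW s0)).
  have := FY s sS; rewrite -[X in 2 * b * X]Fsq.
  move: (sqrtr_ge0 (F s)) (g0 s (ltW s0)) (ltW yp) b0 (ltW s2).
  move: (Num.sqrt (F s)) (Num.sqrt (Y s)) (Num.sqrt 2) (g s) => f y r gs f0 gs0 y0 b0' r0 fy.
  have h1 : r * gs * f <= r * gs * y by rewrite ler_wpM2l // mulr_ge0.
  have h2 : b * f ^+ 2 <= b * y ^+ 2 by rewrite ler_wpM2l // lerXn2r.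
  lra.
apply: (le_trans (FY t _)); first by rewrite t0.
have Et : expR (b * t) * expR (- b * t) = 1 by rewrite -expRD mulNr subrr expR0.
have -> : Num.sqrt (Y t) = expR (b * t) * w t by rewrite /w mulrA Et mul1r.
have -> : prim (fun s => expR (b * (t - s)) * g s) t =
          expR (b * t) * prim (fun s => expR (- b * s) * g s) t.
  rewrite -primZ //; apply: eq_prim => s _.
  by rewrite mulrA -expRD mulrBr mulNr.
have w0 : w 0 <= Num.sqrt M + eta.
  rewrite /w /Y !prim0 !mulr0 expR0 mul1r !addr0.
  rewrite -(@ler_pXn2r _ 2) ?nnegrE ?sqrtr_ge0 ?addr_ge0 ?sqrtr_ge0 ?(ltW eta0) //.
  rewrite sqr_sqrtr ?addr_ge0 ?sqr_ge0 // sqrrD sqr_sqrtr //.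
  by rewrite lerD2r lerDl mulrn_wge0 // mulr_ge0 ?sqrtr_ge0 ?ltW.
have ee : e = expR (b * t) * eta by rewrite /eta mulrC divfK // gt_eqF ?expR_gt0.
rewrite [X in _ <= _ + X]ee; move: wle w0 (expR_gt0 (b * t)).
move: (w t) (w 0) (prim _ t) (Num.sqrt M) (expR _) (Num.sqrt 2)^-1 => x x0 p n E' r.
move=> x1 x2 E0; have -> : r * (E' * p) + E' * n + E' * eta = E' * (r * p + n + eta) by ring.
by rewrite ler_pM2l //; lra.
Qed.
End Gronwall.

(** The best weight is the quotient of the two square roots.  It is used to
    derive the Cauchy-Schwarz inequality for iterated integrals from a pointwise
    inequality. *)
Lemma weighted_young_sqrt (R : realType) (x a b : R) : 0 <= a -> 0 <= b ->
  (forall l, 0 < l -> x <= 2^-1 * (l * a + l^-1 * b)) ->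
  x <= Num.sqrt a * Num.sqrt b.
Proof.
move=> a0 b0 H; apply/ler_addgt0Pr => e e0.
have := H; rewrite -(sqr_sqrtr a0) -(sqr_sqrtr b0) !sqrtr_sqr.
move: (sqrtr_ge0 a) (sqrtr_ge0 b); move: (Num.sqrt a) (Num.sqrt b) => s r s0 r0.
rewrite !ger0_norm // => {}H.
have k0 : 0 < s + r + 1 by rewrite ltr_wpDl // addr_ge0.
(* [h] allows one of [a], [b] to vanish; it costs [h * (s + r)], at most [e]. *)
pose h := e / (s + r + 1); have h0 : 0 < h by rewrite divr_gt0.
have sh : 0 < s + h by rewrite ltr_wpDl.
have rh : 0 < r + h by rewrite ltr_wpDl.
apply: (le_trans (H ((r + h) / (s + h)) (divr_gt0 rh sh))).
have -> : ((r + h) / (s + h))^-1 = (s + h) / (r + h) by rewrite invfM invrK mulrC.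
have q1 : (r + h) / (s + h) * s ^+ 2 <= (r + h) * s.
  rewrite -mulrA ler_pM2l // mulrC ler_pdivrMr // expr2 ler_wpM2l //; lra.
have q2 : (s + h) / (r + h) * r ^+ 2 <= (s + h) * r.
  rewrite -mulrA ler_pM2l // mulrC ler_pdivrMr // expr2 ler_wpM2l //; lra.
have q3 : h * (s + r) <= e.
  by rewrite /h mulrAC ler_pdivrMr // ler_wpM2l ?(ltW e0) //; lra.
lra.
Qed.

Section Energy.
Context {R : realType}.
Notation continuous_half h := {within [set t : R | 0 <= t], continuous h}.

(** The way from the energy balance to the estimate involves time only.  The
    functions [A], [P], [Q], [X], [N], [Phi], [Rr] stand for the volume integrals
    of a Tt^2, K p p, K q q, K q p, Tt Rstar, phi p and Rstar^2 / a, and [Z] for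
    that of phi phi / K_m.  The parameters [k] and [b] cover both ranges of the
    delay times: they vanish in the first one, and are tau_T tau_q^2 / 4 and
    sigma^2 in the second one. *)
Lemma energy_estimate (tq tT Z S k b : R) (A P Q X N Phi Rr : R -> R) :
  0 <= tq -> 0 <= tT -> 0 <= Z ->
  continuous_half A -> continuous_half P -> continuous_half Q ->
  continuous_half N -> continuous_half Phi -> continuous_half Rr ->
  (forall t, 0 <= t -> 0 <= A t) -> (forall t, 0 <= t -> 0 <= P t) ->
  (forall t, 0 <= t -> 0 <= Q t) -> (forall t, 0 <= t -> 0 <= Rr t) ->
  P 0 = 0 -> X 0 = 0 -> Phi 0 = 0 ->
  antideriv P (fun t => 2 * X t) ->
  antideriv (fun t => 2^-1 * A t + 2^-1 * (tq + tT) * P t + 2^-1 * tq ^+ 2 * X t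
                      + 4^-1 * tT * tq ^+ 2 * Q t - tT * Phi t)
    (fun t => - P t + tq * (tq / 2 - tT) * Q t + N t + Phi t) ->
  (forall t, 0 <= t -> Phi t <= 2^-1 * P t + 2^-1 * Z) ->
  (forall t l, 0 <= t -> 0 < l -> N t <= 2^-1 * (l * A t + l^-1 * Rr t)) ->
  0 <= b -> 0 <= k <= 4^-1 * tT * tq ^+ 2 -> tq * (tq / 2 - tT) <= 2 * b * k ->
  let F t := 2^-1 * prim A t + 2^-1 * prim (prim P) t + k * prim Q t in
  let M := S * (2^-1 * A 0 + 4^-1 * tT * tq ^+ 2 * Q 0 + 2^-1 * tT * Z) + S ^+ 2 / 4 * Z in
  forall t, 0 <= t <= S ->
    Num.sqrt (F t) <=
    (Num.sqrt 2)^-1 * prim (fun s => expR (b * (t - s)) * Num.sqrt (prim Rr s)) t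
    + expR (b * t) * Num.sqrt M.
Proof.
move=> tq0 tT0 Z0 cA cP cQ cN cPhi cR A0 P0 Q0 R0 P00 X00 Phi00 aP aL PhiZ NA b0.
move=> /andP[k0 kc] bk F M.
set c := 4^-1 * tT * tq ^+ 2 in aL kc M *; set d := tq * _ in aL bk.
pose cprim := @continuous_half_prim R.
have cc := @within_continuous_cst R R [set t : R | 0 <= t].
have cZ (a : R) (h : R -> R) : continuous_half h -> continuous_half (fun s => a * h s).
  by move=> ch; exact: (within_continuousM (cc a) ch).
have balance t : 0 <= t ->
  2^-1 * A t + 2^-1 * (tq + tT) * P t + 2^-1 * tq ^+ 2 * X t + c * Q t - tT * Phi t
  - (2^-1 * A 0 + c * Q 0) = - prim P t + d * prim Q t + prim N t + prim Phi t.
  move=> t0.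
  have := antideriv_unique aL (antiderivD (antiderivD (antiderivD (antiderivZ (-1)
    (antideriv_prim cP)) (antiderivZ d (antideriv_prim cQ))) (antideriv_prim cN))
    (antideriv_prim cPhi)) t0 _.
  rewrite P00 X00 Phi00 !prim0 !mulr0 !addr0 !subr0 mulN1r; apply.
  by move=> s _; rewrite mulN1r.
have cF : continuous_half F.
  exact: (within_continuousD (within_continuousD (cZ _ _ (cprim _ cA))
    (cZ _ _ (cprim _ (cprim _ cP)))) (cZ _ _ (cprim _ cQ))).
have primF t : 0 <= t -> prim F t = 2^-1 * prim (prim A) t
    + 2^-1 * prim (prim (prim P)) t + k * prim (prim Q) t.
  move=> t0.
  rewrite (prim_unique (antiderivD (antiderivD (antiderivZ 2^-1 (antideriv_prim (cprim _ cA)))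
    (antiderivZ 2^-1 (antideriv_prim (cprim _ (cprim _ cP)))))
    (antiderivZ k (antideriv_prim (cprim _ cQ)))) cF) // !prim0 !mulr0 !addr0.
  by rewrite subr0.
have F0 t : 0 <= t -> 0 <= F t.
  move=> t0; rewrite /F !addr_ge0 // mulr_ge0 ?invr_ge0 ?prim_ge0 // => s _.
  exact: prim_ge0.
have cg : continuous_half (fun s => Num.sqrt (prim Rr s)).
  exact: (within_continuous_fun (@sqrt_continuous R) (cprim _ cR)).
pose r := Num.sqrt 2 : R.
have NF s : 0 <= s -> prim N s <= r * (Num.sqrt (prim Rr s) * Num.sqrt (F s)).
  move=> s0.
  have h : prim N s <= Num.sqrt (prim A s) * Num.sqrt (prim Rr s).
    apply: weighted_young_sqrt; try exact: prim_ge0.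
    move=> l l0.
    have cAR := cZ 2^-1 _ (within_continuousD (cZ l _ cA) (cZ l^-1 _ cR)).
    have := prim_le cN cAR s0 _.
    rewrite (prim_unique (antiderivZ 2^-1 (antiderivD (antiderivZ l (antideriv_prim cA))
      (antiderivZ l^-1 (antideriv_prim cR)))) cAR) //.
    rewrite !prim0 !mulr0 addr0 mulr0 subr0; apply => z /andP[z0 _].
    exact: NA (ltW z0) l0.
  apply: (le_trans h); rewrite (mulrC (Num.sqrt (prim A s))) mulrCA ler_wpM2l ?sqrtr_ge0 //.
  rewrite -sqrtrM // ler_wsqrtr // /F.
  have h1 : 0 <= prim (prim P) s by apply: prim_ge0 => z _; exact: prim_ge0.
  have h2 : 0 <= k * prim Q s by rewrite mulr_ge0 ?prim_ge0.
  lra.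
move=> t /andP[t0 tS].
apply: (gronwall_sqrt (S := S)) => //; last by rewrite t0.
- rewrite /M; have S0 := le_trans t0 tS.
  have c0 : 0 <= c by exact: le_trans kc.
  by rewrite addr_ge0 ?mulr_ge0 ?addr_ge0 ?mulr_ge0 ?invr_ge0 ?sqr_ge0 ?A0 ?Q0 ?ler0n
    ?exprn_ge0.
move=> {t t0 tS} t /andP[t0 tS].
(* The second integration: [X] is half the derivative of [P], whence the
   nonnegative term in [P t] on the left. *)
have step : F t + 4^-1 * tq ^+ 2 * P t <=
   t * (2^-1 * A 0 + c * Q 0 + 2^-1 * tT * Z) + t ^+ 2 / 4 * Z + prim (prim N) t
   + d * prim (prim Q) t.
  have aU := antiderivD (antiderivD (antiderivD (antiderivZ 2^-1 (antideriv_prim cA))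
    (antiderivZ 2^-1 (antideriv_prim (cprim _ cP)))) (antiderivZ k (antideriv_prim cQ)))
    (antiderivZ (4^-1 * tq ^+ 2) aP).
  have aV := antiderivD (antiderivD (antiderivD
    (antiderivZ (2^-1 * A 0 + c * Q 0 + 2^-1 * tT * Z) antideriv_id)
    (antiderivZ (Z / 4) (antiderivM antideriv_id antideriv_id)))
    (antideriv_prim (cprim _ cN))) (antiderivZ d (antideriv_prim (cprim _ cQ))).
  have := antideriv_le aU aV t0 _; rewrite /= !prim0 P00 !mulr0 !addr0 !subr0 => H.
  rewrite [t * _]mulrC (_ : t ^+ 2 / 4 * Z = Z / 4 * (t * t)); last by ring.
  apply: H.
  move=> s /andP[s0 st]; have s0' := ltW s0; have := balance s s0'.
  have h1 : prim Phi s <= 2^-1 * prim P s + 2^-1 * Z * s.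
    have := antideriv_le (antideriv_prim cPhi) (antiderivD
      (antiderivZ 2^-1 (antideriv_prim cP)) (antiderivZ (2^-1 * Z) antideriv_id)) (ltW s0) _.
    rewrite !prim0 !mulr0 addr0 !subr0; apply => z /andP[z0 _].
    by rewrite mulr1; exact: PhiZ (ltW z0).
  have h2 : tT * Phi s <= tT * (2^-1 * P s + 2^-1 * Z) by rewrite ler_wpM2l // PhiZ.
  have h3 : 0 <= tq * P s by rewrite mulr_ge0 // P0.
  have h4 : k * Q s <= c * Q s by rewrite ler_wpM2r // Q0.
  lra.
have cgF := within_continuousM cg (within_continuous_fun (@sqrt_continuous R) cF).
have NN : prim (prim N) t <= r * prim (fun s => Num.sqrt (prim Rr s) * Num.sqrt (F s)) t.
  rewrite -primZ //; apply: prim_le => //; [exact: cprim|exact: cZ|].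
  by move=> s /andP[/ltW + _]; exact: NF.
have QQ : d * prim (prim Q) t <= 2 * b * prim F t.
  have A1 : 0 <= prim (prim A) t by apply: prim_ge0 => s _; exact: prim_ge0.
  have P1 : 0 <= prim (prim (prim P)) t.
    by apply: prim_ge0 => s _; apply: prim_ge0 => z _; exact: prim_ge0.
  have Q1 : 0 <= prim (prim Q) t by apply: prim_ge0 => s _; exact: prim_ge0.
  rewrite primF //; apply: (@le_trans _ _ (2 * b * k * prim (prim Q) t)).
    by rewrite ler_wpM2r.
  rewrite -mulrA ler_wpM2l ?mulr_ge0 //; lra.
have MM : t * (2^-1 * A 0 + c * Q 0 + 2^-1 * tT * Z) + t ^+ 2 / 4 * Z <= M.
  have c0 : 0 <= c by exact: le_trans kc.
  rewrite /M lerD //; first by rewrite ler_wpM2r ?addr_ge0 ?mulr_ge0 ?invr_ge0 ?A0 ?Q0 ?ler0n.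
  by rewrite !ler_wpM2r ?invr_ge0 ?ler0n // lerXn2r // nnegrE (le_trans t0).
have : 0 <= 4^-1 * tq ^+ 2 * P t by rewrite !mulr_ge0 ?sqr_ge0 ?P0.
rewrite -/r; lra.
Qed.
End Energy.

(** * Lebesgue measure on row vectors *)

Section Volume.
Context {R : realType}.
Notation E3 := 'rV[R]_3.

(** The norm is the maximum norm, so its balls are products of intervals. *)
Lemma norm_pt_lt (p : R * R * R) (x : E3) (e : R) : 0 < e ->
  (`|x - pt p| < e) = [&& `|x 0 0 - p.1.1| < e, `|x 0 1 - p.1.2| < e & `|x 0 2%:R - p.2| < e].
Proof.
move=> e0; apply/idP/idP => [H|/and3P[h0 h1 h2]].
  have h i : `|(x - pt p) 0 i| < e.
    apply: le_lt_trans H; rewrite [leRHS]/Num.Def.normr /= mx_normrE.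
    by apply/bigmax_geP; right; exists (0, i).
  have := h 0; have := h 1; have := h 2%:R; rewrite !mxE /= => -> -> -> //.
rewrite [ltLHS]/Num.Def.normr /= mx_normrE; apply/bigmax_ltP; split => //= -[i j] _ /=.
rewrite !ord1 !mxE.
case: j => [[|[|[|//]]]] /= jp.
- by have -> : Ordinal jp = 0 by apply/val_inj.
- by have -> : Ordinal jp = 1 by apply/val_inj.
- by have -> : Ordinal jp = 2%:R by apply/val_inj.
Qed.

(** An open set is the union of the cubes with rational centre and side
    [2 / (k + 1)] which it contains.  There are countably many of them, and they
    are measurable for the product sigma-algebra. *)
Lemma open_measurable_pt (U : set E3) : open U -> measurable (pt @^-1` U).
Proof.
move=> oU.
pose box (i : (rat * rat * rat) * nat) : set (R * R * R) :=
  (ball (ratr i.1.1.1 : R) i.2.+1%:R^-1 `*` ball (ratr i.1.1.2 : R) i.2.+1%:R^-1)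
  `*` ball (ratr i.1.2 : R) i.2.+1%:R^-1.
have -> : pt @^-1` U = \bigcup_(i in [set i | box i `<=` pt @^-1` U]) box i.
  apply/seteqP; split => [p Up|p [i /= iU ip]]; last exact: iU.
  have /nbhs_ballP[e /= e0 eU] : nbhs (pt p) U by apply: open_nbhs_nbhs.
  have [k ke] : exists k : nat, k.+1%:R^-1 < e / 2.
    have e2 : 0 < e / 2 by rewrite divr_gt0.
    by have [k _ /(_ k (leqnn k))] := near_infty_natSinv_lt (PosNum e2); exists k.
  have q (z : R) : exists q : rat, `|ratr q - z| < k.+1%:R^-1.
    have d0 : 0 < k.+1%:R^-1 :> R by rewrite invr_gt0.
    move: (k.+1%:R^-1) d0 => d d0.
    have /rat_in_itvoo[q] : z - d < z + d by lra.
    by rewrite in_itv /= => /andP[? ?]; exists q; rewrite ltr_distlC; apply/andP; split; lra.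
  have [q0 h0] := q p.1.1; have [q1 h1] := q p.1.2; have [q2 h2] := q p.2.
  exists ((q0, q1, q2), k) => //= y [[/= y0 y1] y2].
  apply: eU; rewrite -ball_normE /ball_ /= norm_pt_lt // !mxE /=.
  move: y0 y1 y2; rewrite -!ball_normE /ball_ /= => y0 y1 y2.
  have tri (a b c : R) : `|c - a| < k.+1%:R^-1 -> `|c - b| < k.+1%:R^-1 -> `|a - b| < e.
    move: (k.+1%:R^-1) ke => d ke ca cb; have -> : a - b = (c - b) - (c - a) by ring.
    by apply: le_lt_trans (ler_normB _ _) _; lra.
  by rewrite (tri _ _ _ h0 y0) (tri _ _ _ h1 y1) (tri _ _ _ h2 y2).
rewrite bigcup_mkcond; apply: countable_bigcupT_measurable; first exact: countableP.
move=> i; case: ifPn => // _.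
apply: measurableX; last exact: measurable_realfun.measurable_ball.
by apply: measurableX; exact: measurable_realfun.measurable_ball.
Qed.

Lemma closed_measurable_pt (U : set E3) : closed U -> measurable (pt @^-1` U).
Proof.
move=> cU; rewrite (_ : pt @^-1` U = ~` (pt @^-1` ~` U)).
  by apply: measurableC; apply: open_measurable_pt; exact: closed_openC.
by rewrite preimage_setC setCK.
Qed.

Lemma measurable_fun_pt (A : set E3) (f : E3 -> R) : measurable (pt @^-1` A) ->
  {within A, continuous f} -> measurable_fun (pt @^-1` A) (fun p => f (pt p)).
Proof.
move=> mA /continuousP cf.
apply: (measurability _ (measurable_realfun.RGenOpens.measurableE R)).
move=> _ [_ [a [b ->] <-]].
have /open_subspaceP[V oV VA] := cf _ (@interval_open R (BRight a) (BLeft b) isT isT).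
rewrite (_ : _ `&` _ = pt @^-1` V `&` pt @^-1` A); last first.
  by rewrite -preimage_setI VA setIC.
by apply: measurableI => //; exact: open_measurable_pt.
Qed.

Notation mu3 := ((@lebesgue_measure R \x @lebesgue_measure R) \x @lebesgue_measure R)%E.

Lemma bounded_volume (B : set E3) : bounded_set B -> measurable (pt @^-1` B) ->
  (mu3 (pt @^-1` B) < +oo)%E.
Proof.
move=> [M [_ HM]] mB; pose N := `|M| + 1.
have MN : M < N by rewrite /N ltr_pwDr // ler_norm.
pose I : set R := `[- N, N]%classic.
have mI : measurable I by exact: measurable_itv.
have sub : pt @^-1` B `<=` (I `*` I) `*` I.
  move=> p Bp; have := HM N MN _ Bp => pN.
  have h i : `|pt p 0 i| <= N.
    apply: le_trans pN; rewrite [leRHS]/Num.Def.normr /= mx_normrE.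
    by apply/bigmax_geP; right; exists (0, i).
  have := h 0; have := h 1; have := h 2%:R; rewrite !mxE /= !ler_norml => h2 h1 h0.
  by split; [split|]; rewrite /I /= in_itv.
have mI2 : measurable (I `*` I) by exact: measurableX.
apply: (@le_lt_trans _ _ (mu3 ((I `*` I) `*` I))).
  by apply: le_measure => //; rewrite ?inE //; exact: measurableX.
have fI : ((@lebesgue_measure R) I < +oo)%E.
  by rewrite lebesgue_measure_itv /=; case: ifP; rewrite ?ltry.
have -> : mu3 ((I `*` I) `*` I) =
    ((@lebesgue_measure R) I * (@lebesgue_measure R) I * (@lebesgue_measure R) I)%E.
  transitivity (((@lebesgue_measure R) \x (@lebesgue_measure R))%E (I `*` I) *
    (@lebesgue_measure R) I)%E.
    exact: product_measure1E.
  by congr (_ * _)%E; exact: product_measure1E.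
move: fI; rewrite -!ge0_fin_numE ?measure_ge0 ?mule_ge0 //.
by move=> fI; rewrite !fin_numM.
Qed.

End Volume.

(** * Volume integrals *)

Lemma bounded_set_closure (R : realType) (V : normedModType R) (A : set V) :
  bounded_set A -> bounded_set (closure A).
Proof.
move=> [M [Mr HM]]; exists M; split => // x Mx y cy.
have cN : closed [set z : V | `|z| <= x].
  rewrite (_ : mkset _ = (@Num.norm R V) @^-1` [set r | r <= x]) //.
  by apply: closed_comp; [move=> z _; exact: norm_continuous|exact: closed_le].
by apply: cN; apply: closure_subset cy => z Az; exact: HM.
Qed.

Section VolumeIntegral.
Context {R : realType} (B : set 'rV[R]_3).
Context (openB : open B) (boundedB : bounded_set B).
Notation E3 := 'rV[R]_3.
Notation C := (closure B).
Notation half := [set t : R | 0 <= t].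
Notation mu3 := ((@lebesgue_measure R \x @lebesgue_measure R) \x @lebesgue_measure R)%E.
Notation continuous_half h := {within [set t : R | 0 <= t], continuous h}.

Lemma compact_closure : compact C.
Proof.
by apply: bounded_closed_compact; [exact: bounded_set_closure|exact: closed_closure].
Qed.

Lemma measurable_region : measurable (pt @^-1` B).
Proof. exact: open_measurable_pt. Qed.

Lemma vol_integrable f : cont_on C f -> mu3.-integrable (pt @^-1` B) (fun p => (f (pt p))%:E).
Proof.
move=> cf; apply: measurable_bounded_integrable.
- exact: measurable_region.
- exact: bounded_volume measurable_region.
- apply: measurable_fun_pt; first exact: measurable_region.
  by apply: continuous_subspaceW cf; exact: subset_closure.
have /compact_bounded[M [Mr HM]] := continuous_compact cf compact_closure.
exists M; split => // x Mx p Bp; apply: HM Mx _ _.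
by exists (pt p) => //; exact: subset_closure.
Qed.

Lemma eq_vol_int f g : (forall x, B x -> f x = g x) -> vol_int B f = vol_int B g.
Proof. by move=> fg; apply: eq_Rintegral => p /set_mem /=; exact: fg. Qed.

Lemma vol_intD f g : cont_on C f -> cont_on C g ->
  vol_int B (fun x => f x + g x) = vol_int B f + vol_int B g.
Proof.
move=> /vol_integrable cf /vol_integrable cg.
by apply: RintegralD => //; exact: measurable_region.
Qed.

Lemma vol_intZ c f : cont_on C f -> vol_int B (fun x => c * f x) = c * vol_int B f.
Proof. by move=> cf; apply: RintegralZl; [exact: measurable_region|exact: vol_integrable]. Qed.

Lemma vol_intB f g : cont_on C f -> cont_on C g ->
  vol_int B (fun x => f x - g x) = vol_int B f - vol_int B g.
Proof.
move=> /vol_integrable cf /vol_integrable cg.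
by apply: RintegralB => //; exact: measurable_region.
Qed.

Lemma vol_int0 f : (forall x, B x -> f x = 0) -> vol_int B f = 0.
Proof.
move=> f0; rewrite (eq_vol_int (g := fun=> 0 * 1)) => [|x Bx]; last by rewrite mul0r f0.
by rewrite vol_intZ ?mul0r //; exact: within_continuous_cst.
Qed.

Lemma vol_int_ge0 f : (forall x, B x -> 0 <= f x) -> 0 <= vol_int B f.
Proof. by move=> f0; apply: Rintegral_ge0 => p; exact: f0. Qed.

Lemma vol_int_le f g : cont_on C f -> cont_on C g -> (forall x, B x -> f x <= g x) ->
  vol_int B f <= vol_int B g.
Proof.
move=> /vol_integrable cf /vol_integrable cg fg; apply: le_Rintegral => //.
  exact: measurable_region.
by move=> p; exact: fg.
Qed.

Lemma vol_int_norm_le f (e : R) : cont_on C f -> (forall x, B x -> `|f x| <= e) ->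
  `|vol_int B f| <= e * vol_int B (fun=> 1).
Proof.
move=> cf fe; have c1 := @within_continuous_cst R _ C 1.
have cZ r : cont_on C (fun=> r * 1) := @within_continuous_cst R _ C (r * 1).
rewrite ler_norml -mulNr -!vol_intZ //.
have f2 x : B x -> - e * 1 <= f x <= e * 1 by move=> Bx; rewrite !mulr1 -ler_norml; exact: fe.
apply/andP; split.
  by apply: (vol_int_le (cZ (- e)) cf) => x /f2 /andP[].
by apply: (vol_int_le cf (cZ e)) => x /f2 /andP[].
Qed.

Lemma cont_cyl_slice f t : cont_cyl C f -> 0 <= t -> cont_on C (f ^~ t).
Proof.
move=> cf t0; apply: (within_continuous_sub (h := fun x => (x, t))) cf => //= x.
move=> W [[U V] /= [Ux Vt] UV]; apply: filterS Ux => y Uy.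
by apply: UV; split => //=; exact: nbhs_singleton.
Qed.

Lemma cont_cyl_time f x : cont_cyl C f -> C x -> continuous_half (f x).
Proof.
move=> cf Cx; apply: (within_continuous_sub (h := fun t => (x, t))) cf => //= t.
move=> W [[U V] /= [Ux Vt] UV]; apply: filterS Vt => y Vy.
by apply: UV; split => //=; exact: nbhs_singleton.
Qed.

Lemma cont_cyl_space (f : E3 -> R) : cont_on C f -> cont_cyl C (fun x _ => f x).
Proof.
move=> cf; apply: (within_continuous_sub (h := fst)) cf => //=; last by move=> p [].
by move=> p U pU; exists (U, setT) => /=; [split=> //; exact: filterT|move=> y []].
Qed.

Lemma continuous_vol_int f : cont_cyl C f -> continuous_half (fun t => vol_int B (f ^~ t)).
Proof.
move=> cf; apply/subspace_continuousP => t0 /= t00; apply/cvgrPdist_le => e e0.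
set V := vol_int B (fun=> 1).
have V0 : 0 <= V by apply: vol_int_ge0.
have d0 : 0 < e / (V + 1) by rewrite divr_gt0 // ltr_wpDl.
have := tube (Z := half) compact_closure t00 d0 cf.
rewrite -nbhs_nearE near_withinE; apply: filterS => t H t_ge0.
rewrite distrC -vol_intB; try exact: cont_cyl_slice.
apply: (le_trans (vol_int_norm_le (e := e / (V + 1)) _ _)).
- by apply: within_continuousB; exact: cont_cyl_slice.
- by move=> x Bx; apply: ltW; apply: H => //; exact: subset_closure.
by rewrite -/V mulrAC ler_pdivrMr ?ltr_wpDl // ler_wpM2l ?(ltW e0) // lerDl.
Qed.

(** By the tube lemma, [u] oscillates little in time, uniformly over [B], so that
    the increment estimate for [f x] can be integrated over [B]. *)
Lemma antideriv_vol_int f u : cont_cyl C f -> cont_cyl C u ->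
  (forall x (t : R), B x -> 0 < t -> is_derive t 1 (f x) (u x t)) ->
  antideriv (fun t => vol_int B (f ^~ t)) (fun t => vol_int B (u ^~ t)).
Proof.
move=> cf cu fu; split=> [|t t0]; first exact: continuous_vol_int.
apply: is_derive_eps => e e0.
set V := vol_int B (fun=> 1).
have V0 : 0 <= V by apply: vol_int_ge0.
have d0 : 0 < e / (V + 1) by rewrite divr_gt0 // ltr_wpDl.
have /nbhs_ballP[d /= d1 Hd] := tube (Z := half) compact_closure (ltW t0) d0 cu.
near=> h.
have hd : `|h| < d by near: h; exists d => // z /=; rewrite sub0r normrN.
have ht : `|h| < t by near: h; exists t => // z /=; rewrite sub0r normrN.
have ht0 : 0 <= h + t by move: ht; rewrite ltr_norml => /andP[? _]; lra.
have cfh := cont_cyl_slice cf ht0; have cft := cont_cyl_slice cf (ltW t0).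
have cut := cont_cyl_slice cu (ltW t0).
have chu : cont_on C (fun x => h * u x t).
  exact: (within_continuousM (@within_continuous_cst R _ C h) cut).
have cB1 : cont_on C (fun x => f x (h + t) - f x t) := within_continuousB cfh cft.
have cB2 : cont_on C (fun x => f x (h + t) - f x t - h * u x t) := within_continuousB cB1 chu.
rewrite (_ : h *: 1 + t = h + t); last by rewrite /GRing.scale /= mulr1.
rewrite -vol_intZ // -!vol_intB //.
apply: (le_trans (vol_int_norm_le (e := e / (V + 1) * `|h|) cB2 _)).
  move=> x Bx; have Cx := subset_closure Bx.
  apply: (@mvt_increment R (f x) (u x)) => s sh.
    apply: fu => //; have := le_lt_trans sh ht; rewrite ltr_distlC => /andP[]; lra.
  have s0 : 0 <= s by have := le_lt_trans sh ht; rewrite ltr_distlC => /andP[]; lra.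
  apply/ltW/Hd => //; rewrite -ball_normE /ball_ /= distrC.
  exact: le_lt_trans sh hd.
rewrite -/V mulrAC ler_wpM2r // mulrAC ler_pdivrMr ?ltr_wpDl // ler_wpM2l ?(ltW e0) //.
by rewrite lerDl.
Unshelve. all: by end_near. Qed.

End VolumeIntegral.

(** * Time integrals of fields *)

Section Cylinder.
Context {R : realType} (B : set 'rV[R]_3).
Context (openB : open B).
Notation E3 := 'rV[R]_3.
Notation C := (closure B).
Notation half := [set t : R | 0 <= t].
Notation continuous_half h := {within [set t : R | 0 <= t], continuous h}.

(** The tube lemma in which the time interval is the compact factor. *)
Lemma time_tube (f : E3 -> R -> R) (x0 : E3) (T e : R) : cont_cyl C f -> C x0 -> 0 < e ->
  \forall x \near x0, C x -> forall s, 0 <= s <= T -> `|f x s - f x0 s| < e.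
Proof.
move=> cf Cx0 e0.
have H : {within `[0, T]%classic `*` C, continuous (fun p : R * E3 => f p.2 p.1)}.
  apply: (within_continuous_sub (h := fun p : R * E3 => (p.2, p.1))) cf.
    exact: swap_continuous.
  by move=> [s x] /= [+ Cx]; rewrite in_itv /= => /andP[].
have := @tube R R E3 _ C (fun s x => f x s) x0 e (@segment_compact R 0 T) Cx0 e0 H.
by apply: filterS => x Hx Cx s sT; apply: Hx => //=; rewrite in_itv.
Qed.

(** The position is varied first, at constant time, where [time_tube] bounds the
    difference of the integrands; then the time is varied at the position [x0]. *)
Lemma cont_cyl_prim f : cont_cyl C f -> cont_cyl C (fun x => prim (f x)).
Proof.
move=> cf; apply/subspace_continuousP => -[x0 t0] [/= Cx0 t00].
apply/cvgrPdist_le => e e0; rewrite near_withinE.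
have cfx0 := cont_cyl_time cf Cx0.
have k0 : 0 < t0 + 2 by rewrite ltr_wpDl.
have d0 : 0 < e / 2 / (t0 + 2) by rewrite !divr_gt0.
have e2 : 0 < e / 2 by rewrite divr_gt0.
have Hx := time_tube (t0 + 1) cf Cx0 d0.
have Ht : \forall t \near t0, 0 <= t -> `|prim (f x0) t0 - prim (f x0) t| <= e / 2.
  have /subspace_continuousP/(_ t0 t00) := continuous_half_prim cfx0.
  by move/cvgrPdist_le/(_ _ e2); rewrite near_withinE.
have Ht1 : \forall t \near t0, t <= t0 + 1.
  by apply: lt_le_nbhsl; rewrite ltrDl.
exists ([set x | C x -> forall s, 0 <= s <= t0 + 1 -> `|f x s - f x0 s| < e / 2 / (t0 + 2)],
  [set t | (0 <= t -> `|prim (f x0) t0 - prim (f x0) t| <= e / 2) /\ t <= t0 + 1]).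
  by split => //=; exact: filterI.
move=> [x t] /= [H1 [H2 t1]] [Cx t_ge0].
have cfx := cont_cyl_time cf Cx.
have := antideriv_norm_le (antiderivB (antideriv_prim cfx) (antideriv_prim cfx0)) t_ge0
  (c := e / 2 / (t0 + 2)) _.
rewrite !prim0 !subr0 => H3.
have {}H3 : `|prim (f x) t - prim (f x0) t| <= e / 2.
  apply: le_trans (H3 _) _.
    move=> s /andP[s0 st]; apply/ltW/H1 => //.
    by rewrite (ltW s0) (le_trans (ltW st)).
  by rewrite mulrAC ler_pdivrMr // ler_wpM2l ?(ltW e2) //; lra.
have -> : prim (f x0) t0 - prim (f x) t =
  (prim (f x0) t0 - prim (f x0) t) - (prim (f x) t - prim (f x0) t) by ring.
by apply: le_trans (ler_normB _ _) _; have := H2 t_ge0; lra.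
Qed.

Notation e_ i := (delta_mx 0 i : E3).

(** The estimate is uniform in time, so it can be integrated in time or taken
    to the limit at time 0. *)
Lemma space_increment (i : 'I_3) (f G : E3 -> R -> R) (x : E3) (T e : R) :
  cont_cyl C G -> (forall y s, B y -> 0 < s -> is_derive y (e_ i) (f ^~ s) (G y s)) ->
  B x -> 0 < e ->
  \forall h \near (0 : R), forall s, 0 < s <= T ->
    `|f (h *: e_ i + x) s - f x s - h * G x s| <= e * `|h|.
Proof.
move=> cG fG Bx e0; have Cx := subset_closure Bx.
have H1 := time_tube T cG Cx e0.
have H2 : \forall y \near x, B y by apply: open_nbhs_nbhs.
have Hcvg := @line_cvg _ _ (e_ i) x _ (filterI H1 H2).
have /nbhs_ballP[d /= d0 Hd] : \forall a \near (0 : R), (C (a *: e_ i + x) ->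
    forall s, 0 <= s <= T -> `|G (a *: e_ i + x) s - G x s| < e) /\ B (a *: e_ i + x).
  exact: Hcvg.
exists d => // h /=; rewrite sub0r normrN => hd s /andP[s0 sT].
have Hdh a : `|a| <= `|h| -> B (a *: e_ i + x) /\ `|G (a *: e_ i + x) s - G x s| < e.
  move=> ah; have [|A1 A2] := Hd a.
    by rewrite -ball_normE /ball_ /= sub0r normrN (le_lt_trans ah).
  by split => //; apply: A1; [exact: subset_closure|rewrite (ltW s0)].
have := @mvt_increment R (fun a => f (a *: e_ i + x) s) (fun a => G (a *: e_ i + x) s) 0 h e.
rewrite addr0 scale0r add0r; apply => a; rewrite subr0 => /Hdh[Ba Ga].
  exact: (is_derive_line (g := f ^~ s) (fG _ _ Ba s0)).
exact: ltW.
Qed.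

(** At time 0 the derivative is obtained as a limit of [space_increment].  For
    the temperature this identifies the gradient of the initial temperature with
    the limit of the gradients at positive times. *)
Lemma is_derive_space_ge0 (i : 'I_3) (f G : E3 -> R -> R) (x : E3) (t : R) :
  cont_cyl C f -> cont_cyl C G ->
  (forall y s, B y -> 0 < s -> is_derive y (e_ i) (f ^~ s) (G y s)) ->
  B x -> 0 <= t -> is_derive x (e_ i) (f ^~ t) (G x t).
Proof.
move=> cf cG fG Bx; rewrite le_eqVlt => /predU1P[<-|]; last exact: fG.
apply: is_derive_eps => e e0.
have H1 := space_increment 1 cG fG Bx e0.
have H2 : \forall h \near (0 : R), B (h *: e_ i + x).
  by apply: (@line_cvg _ _ (e_ i) x); exact: open_nbhs_nbhs.
near=> h.
have Bh : B (h *: e_ i + x) by near: h.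
have cD : continuous_half (fun s => `|f (h *: e_ i + x) s - f x s - h * G x s|).
  apply: (within_continuous_fun (h := Num.norm)); first exact: norm_continuous.
  have c1 := cont_cyl_time cf (subset_closure Bh).
  have c2 := cont_cyl_time cf (subset_closure Bx).
  have c3 := cont_cyl_time cG (subset_closure Bx).
  have c4 := @within_continuous_cst R _ half h.
  exact: (within_continuousB (within_continuousB c1 c2) (within_continuousM c4 c3)).
apply: (continuous_half_le0 cD ltr01) => s s1.
by move: s s1; near: h.
Unshelve. all: by end_near. Qed.

Lemma is_derive_space_prim (i : 'I_3) (f G : E3 -> R -> R) (x : E3) (t : R) :
  cont_cyl C f -> cont_cyl C G ->
  (forall y s, B y -> 0 < s -> is_derive y (e_ i) (f ^~ s) (G y s)) ->
  B x -> 0 <= t -> is_derive x (e_ i) (fun y => prim (f y) t) (prim (G x) t).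
Proof.
move=> cf cG fG Bx t0; apply: is_derive_eps => e e0.
have k0 : 0 < t + 1 by rewrite ltr_wpDl.
have d0 : 0 < e / (t + 1) by rewrite divr_gt0.
have H1 := space_increment t cG fG Bx d0.
have H2 : \forall h \near (0 : R), B (h *: e_ i + x).
  by apply: (@line_cvg _ _ (e_ i) x); exact: open_nbhs_nbhs.
near=> h.
have Bh : B (h *: e_ i + x) by near: h.
have c1 := cont_cyl_time cf (subset_closure Bh).
have c2 := cont_cyl_time cf (subset_closure Bx).
have c3 := cont_cyl_time cG (subset_closure Bx).
have := antideriv_norm_le (c := e / (t + 1) * `|h|) (antiderivB (antiderivB (antideriv_prim c1)
  (antideriv_prim c2)) (antiderivZ h (antideriv_prim c3))) t0 _.
rewrite !prim0 mulr0 !subr0 => H; apply: le_trans (H _) _.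
  move=> s /andP[s0 st]; have : 0 < s <= t by rewrite s0 ltW.
  by move: s {s0 st}; near: h.
rewrite mulrAC ler_wpM2r // mulrAC ler_pdivrMr // ler_wpM2l ?(ltW e0) //; lra.
Unshelve. all: by end_near. Qed.

End Cylinder.

(** * Quadratic forms and eigenvalues *)

Lemma sum_mx_col (R : comUnitRingType) n (A : 'M[R]_n) (u : 'I_n -> R) i :
  \sum_j A i j * u j = (A *m \col_j u j) i 0.
Proof. by rewrite mxE; apply: eq_bigr => j _; rewrite mxE. Qed.

Lemma solve_invmx (R : comUnitRingType) n (A : 'M[R]_n) (w z : 'I_n -> R) : A \in unitmx ->
  (forall i, w i = \sum_j A i j * z j) -> forall i, z i = \sum_j invmx A i j * w j.
Proof.
move=> uA wz i; rewrite sum_mx_col.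
have -> : \col_j w j = A *m \col_j z j by apply/colP => j; rewrite mxE wz sum_mx_col.
by rewrite mulmxA mulVmx // mul1mx mxE.
Qed.

Section QuadraticForms.
Context {R : realType}.
Implicit Types (A k : 'M[R]_3) (u v w p : 'I_3 -> R).

Lemma quadE A u v : quad A u v = ((\row_i u i) *m A *m (\col_j v j)) 0 0.
Proof.
rewrite /quad !mxE exchange_big; apply: eq_bigr => j _ /=.
rewrite !mxE mulr_suml; apply: eq_bigr => i _; rewrite !mxE; ring.
Qed.

Lemma quadC A u v : A^T = A -> quad A u v = quad A v u.
Proof.
move=> AT; rewrite /quad exchange_big; apply: eq_bigr => j _; apply: eq_bigr => i _ /=.
by rewrite -{1}AT mxE; ring.
Qed.

Lemma quadDl A u u' v : quad A (fun i => u i + u' i) v = quad A u v + quad A u' v.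
Proof.
rewrite /quad -big_split; apply: eq_bigr => i _; rewrite -big_split.
by apply: eq_bigr => j _ /=; ring.
Qed.

Lemma quadZl A (c : R) u v : quad A (fun i => c * u i) v = c * quad A u v.
Proof.
rewrite /quad mulr_sumr; apply: eq_bigr => i _; rewrite mulr_sumr.
by apply: eq_bigr => j _ /=; ring.
Qed.

Definition sqnorm u : R := \sum_i u i * u i.

Lemma sqnorm_gt0 u i : u i != 0 -> 0 < sqnorm u.
Proof.
move=> ui; apply: lt_le_trans (_ : u i * u i <= _).
  by rewrite -expr2 exprn_even_gt0.
by rewrite /sqnorm (bigD1 i) //= lerDl sumr_ge0 // => j _; rewrite -expr2 sqr_ge0.
Qed.

Lemma eigenvalue_quad A (l : R) : eigenvalue A l ->
  exists2 v, 0 < sqnorm v & quad A v v = l * sqnorm v.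
Proof.
move=> /eigenvalueP[v vA v0]; exists (fun i => v 0 i).
  have /matrix0Pn[i [j vij]] := v0; apply: (@sqnorm_gt0 _ j).
  by rewrite ord1 in vij.
rewrite quadE (_ : \row_i v 0 i = v); last by apply/rowP => i; rewrite mxE.
rewrite vA -scalemxAl mxE; congr (_ * _); rewrite !mxE; apply: eq_bigr => j _.
by rewrite !mxE.
Qed.

Context (k : 'M[R]_3) (ksym : k^T = k) (low : 0 < lowest_eigenvalue k).
Context (kquad : forall u, lowest_eigenvalue k * sqnorm u <= quad k u u /\
  quad k u u <= greatest_eigenvalue k * sqnorm u).

Lemma quad_ge0 u : 0 <= quad k u u.
Proof.
apply: le_trans (kquad u).1; rewrite mulr_ge0 ?(ltW low) //.
by apply: sumr_ge0 => i _; rewrite -expr2 sqr_ge0.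
Qed.

Lemma eigenvalue_gt0 (l : R) : eigenvalue k l -> 0 < l.
Proof.
move=> /eigenvalue_quad[v v0 E]; have := (kquad v).1; rewrite E ler_pM2r //.
exact: lt_le_trans.
Qed.

Lemma eigenvalue_le (l : R) : eigenvalue k l -> l <= greatest_eigenvalue k.
Proof. by move=> /eigenvalue_quad[v v0 E]; have := (kquad v).2; rewrite E ler_pM2r. Qed.

Lemma posdef_unit : k \in unitmx.
Proof.
rewrite -[_ \in _]negbK; apply/negP => H.
have : eigenvalue k 0.
  apply/eigenvalueP; move: H; rewrite -row_free_unit -kermx_eq0.
  move=> /rowV0Pn[v /sub_kermxP vk v0]; exists v => //.
  by rewrite vk scale0r.
by move=> /eigenvalue_gt0; rewrite ltxx.
Qed.

Lemma has_eigenvalue : exists l, eigenvalue k l.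
Proof.
have [|/set0P[l] //] := eqVneq [set l : R | eigenvalue k l] set0; last by exists l.
by move=> E; move: low; rewrite /lowest_eigenvalue E inf0 ltxx.
Qed.

Lemma greatest_eigenvalue_gt0 : 0 < greatest_eigenvalue k.
Proof.
by have [l kl] := has_eigenvalue; exact: lt_le_trans (eigenvalue_gt0 kl) (eigenvalue_le kl).
Qed.

Lemma eigenvalue_inv A (l : R) : A \in unitmx -> l != 0 -> eigenvalue A l ->
  eigenvalue (invmx A) l^-1.
Proof.
move=> uA l0 /eigenvalueP[v vA v0]; apply/eigenvalueP; exists v => //.
apply: (canRL (scalerK l0)); rewrite scalemxAl -vA -mulmxA.
by rewrite mulmxV // mulmx1.
Qed.

(** The eigenvalues of the inverse are the inverses of the eigenvalues.  This
    turns 1 / K_m into the constant of the upper bound of the form of [k]. *)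
Lemma lowest_eigenvalue_invmx : (lowest_eigenvalue (invmx k))^-1 = greatest_eigenvalue k.
Proof.
have uk := posdef_unit; have g0 := greatest_eigenvalue_gt0.
have lb l : eigenvalue (invmx k) l -> (greatest_eigenvalue k)^-1 <= l.
  move=> Kl; have l0 : l != 0.
    apply: contraTneq Kl => ->; apply/negP => /eigenvalueP[v].
    rewrite scale0r => vK /eqP[]; apply: (can_inj (mulmxK (m := 1) (_ : invmx k \in unitmx))).
      by rewrite unitmx_inv.
    by rewrite vK mul0mx.
  have := eigenvalue_inv _ l0 Kl; rewrite unitmx_inv invmxK => /(_ uk) kl.
  rewrite -[l]invrK lef_pV2 ?posrE ?eigenvalue_le //.
  exact: eigenvalue_gt0.
have hl : has_inf [set l : R | eigenvalue (invmx k) l].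
  split; last by exists (greatest_eigenvalue k)^-1 => l; exact: lb.
  have [l kl] := has_eigenvalue; exists l^-1 => /=.
  by apply: eigenvalue_inv => //; rewrite gt_eqF // eigenvalue_gt0.
have low_ge : (greatest_eigenvalue k)^-1 <= lowest_eigenvalue (invmx k).
  by apply: lb_le_inf => [|l]; [case: hl|exact: lb].
have low0 : 0 < lowest_eigenvalue (invmx k) by apply: lt_le_trans low_ge; rewrite invr_gt0.
apply/eqP; rewrite eq_le; apply/andP; split.
  by rewrite -[leRHS]invrK lef_pV2 ?posrE ?invr_gt0.
apply: ge_sup; first by have [l kl] := has_eigenvalue; exists l.
move=> l /= kl; have l0 := eigenvalue_gt0 kl.
rewrite -[leLHS]invrK lef_pV2 ?posrE ?invr_gt0 //.
apply: inf_lbound; first by case: hl.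
by apply: eigenvalue_inv => //; rewrite gt_eqF.
Qed.

Lemma trmx_invmx : (invmx k)^T = invmx k.
Proof. by rewrite trmx_inv ksym. Qed.

(** The form of [k] is nonnegative at [u - invmx k * p]. *)
Lemma quad_young u p : \sum_i u i * p i <=
  2^-1 * quad (invmx k) p p + 2^-1 * (greatest_eigenvalue k * sqnorm u).
Proof.
have uk := posdef_unit.
pose w i := u i - \sum_j invmx k i j * p j.
have E : quad k w w = quad k u u - 2 * (\sum_i u i * p i) + quad (invmx k) p p.
  have colw : \col_i w i = (\row_i u i)^T - invmx k *m \col_j p j.
    apply/colP => i; rewrite !mxE /w; congr (_ - _).
    by apply: eq_bigr => j _; rewrite !mxE.
  have roww : \row_i w i = \row_i u i - (\col_j p j)^T *m invmx k.
    rewrite (_ : \row_i w i = (\col_i w i)^T); last by apply/rowP => i; rewrite !mxE.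
    by rewrite colw linearB /= trmxK trmx_mul trmx_invmx.
  have colu : (\row_i u i)^T = \col_i u i by apply/colP => i; rewrite !mxE.
  have rowp : (\col_j p j)^T = \row_j p j by apply/rowP => i; rewrite !mxE.
  have S1 : (\row_i u i *m \col_j p j) 0 0 = \sum_i u i * p i.
    by rewrite mxE; apply: eq_bigr => i _; rewrite !mxE.
  have S2 : (\row_i p i *m \col_j u j) 0 0 = \sum_i u i * p i.
    by rewrite mxE; apply: eq_bigr => i _; rewrite !mxE mulrC.
  rewrite quadE colw roww colu rowp !mulmxBl !mulmxBr -!mulmxA.
  rewrite (mulmxA k (invmx k)) mulmxV // mul1mx.
  rewrite (mulmxA (invmx k) k) mulVmx // mul1mx.
  have subE (a b : 'M[R]_1) : (a - b) 0 0 = a 0 0 - b 0 0 by rewrite !mxE.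
  rewrite !mulmxA !subE S1 S2 -!quadE; ring.
have := quad_ge0 w; rewrite E; have := (kquad u).2; lra.
Qed.

Lemma quad_inv_ge0 p : 0 <= quad (invmx k) p p.
Proof.
have uk := posdef_unit.
rewrite (_ : quad _ p p = quad k (fun i => \sum_j invmx k i j * p j)
                                (fun i => \sum_j invmx k i j * p j)) ?quad_ge0 //.
have E : \col_i (\sum_j invmx k i j * p j) = invmx k *m \col_j p j.
  by apply/colP => i; rewrite !mxE; apply: eq_bigr => j _; rewrite !mxE.
rewrite !quadE (_ : \row_i (\sum_j invmx k i j * p j) = (invmx k *m \col_j p j)^T).
  rewrite E trmx_mul trmx_invmx -!mulmxA (mulmxA k) mulmxV // mul1mx.
  by congr ((_ *m _) 0 0); apply/rowP => i; rewrite !mxE.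
by rewrite -E; apply/rowP => i; rewrite !mxE.
Qed.

End QuadraticForms.

Section MatrixContinuity.
Context {R : realType} {X : topologicalType} (A : set X).

Lemma within_continuous_det n (F : X -> 'M[R]_n) :
  (forall i j, {within A, continuous (fun x => F x i j)}) ->
  {within A, continuous (fun x => \det (F x))}.
Proof.
move=> cF; apply: within_continuous_sum => s.
apply: within_continuousM; first exact: within_continuous_cst.
by apply: within_continuous_prod => i; exact: cF.
Qed.

Lemma within_continuous_invmx n (F : X -> 'M[R]_n) (i j : 'I_n) :
  (forall i j, {within A, continuous (fun x => F x i j)}) ->
  (forall x, A x -> F x \in unitmx) ->
  {within A, continuous (fun x => invmx (F x) i j)}.
Proof.
move=> cF uF.
have E x : A x -> (\det (F x))^-1 * cofactor (F x) j i = invmx (F x) i j.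
  by move=> Ax; rewrite /invmx uF // !mxE.
apply: (eq_within_continuous E); apply: within_continuousM.
  apply: within_continuousV; last exact: within_continuous_det.
  by move=> x Ax; have := uF x Ax; rewrite unitmxE unitfE.
apply: within_continuousM; first exact: within_continuous_cst.
apply: within_continuous_det => a b.
by under eq_fun do rewrite !mxE; exact: cF.
Qed.

Lemma within_continuous_quad (F : X -> 'M[R]_3) (u v : 'I_3 -> X -> R) :
  (forall i j, {within A, continuous (fun x => F x i j)}) ->
  (forall i, {within A, continuous (u i)}) -> (forall i, {within A, continuous (v i)}) ->
  {within A, continuous (fun x => quad (F x) (u ^~ x) (v ^~ x))}.
Proof.
move=> cF cu cv; apply: within_continuous_sum => i; apply: within_continuous_sum => j.
by apply: within_continuousM => //; exact: within_continuousM.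
Qed.

Lemma quad_le_norm (D : 'M[R]_3) v : quad D v v <= (\sum_i \sum_j `|D i j|) * sqnorm v.
Proof.
rewrite /quad mulr_suml; apply: ler_sum => i _; rewrite mulr_suml; apply: ler_sum => j _.
apply: le_trans (ler_norm _) _; rewrite -mulrA normrM ler_wpM2l // normrM.
have sq l : `|v l| ^+ 2 <= sqnorm v.
  rewrite -normrX ger0_norm ?sqr_ge0 // /sqnorm (bigD1 l) //= expr2 lerDl.
  by apply: sumr_ge0 => m _; rewrite -expr2 sqr_ge0.
have := sq i; have := sq j; have := sqr_ge0 (`|v i| - `|v j|); rewrite sqrrB; lra.
Qed.

(** An eigenvector of [k] is a test vector for the form of [l]. *)
Lemma greatest_eigenvalue_lipschitz (k l : 'M[R]_3) : 0 < lowest_eigenvalue k ->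
  (forall u, quad l u u <= greatest_eigenvalue l * sqnorm u) ->
  greatest_eigenvalue k <= greatest_eigenvalue l + \sum_i \sum_j `|l i j - k i j|.
Proof.
move=> low lquad; apply: ge_sup; first by have [e ke] := has_eigenvalue low; exists e.
move=> e /= /eigenvalue_quad[v v0 E].
rewrite -(ler_pM2r v0) -E.
have -> : quad k v v = quad l v v + quad (k - l) v v.
  rewrite /quad -big_split; apply: eq_bigr => i _; rewrite -big_split.
  by apply: eq_bigr => j _ /=; rewrite !mxE; ring.
rewrite mulrDl lerD // (le_trans (quad_le_norm _ _)) // ler_wpM2r ?(ltW v0) //.
by apply: ler_sum => i _; apply: ler_sum => j _; rewrite !mxE distrC.
Qed.

(** Makes 1 / K_m continuous on the closure of the region, hence its products
    with continuous functions integrable. *)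
Lemma within_continuous_greatest (F : X -> 'M[R]_3) :
  (forall i j, {within A, continuous (fun x => F x i j)}) ->
  (forall x, A x -> 0 < lowest_eigenvalue (F x)) ->
  (forall x, A x -> forall u, quad (F x) u u <= greatest_eigenvalue (F x) * sqnorm u) ->
  {within A, continuous (fun x => greatest_eigenvalue (F x))}.
Proof.
move=> cF low Fq; apply/subspace_continuousP => x Ax; apply/cvgrPdist_lt => e e0.
have : {within A, continuous (fun y => \sum_i \sum_j `|F x i j - F y i j|)}.
  do 2 (apply: within_continuous_sum => ?).
  apply: (within_continuous_fun (h := Num.norm)); first exact: norm_continuous.
  by apply: within_continuousB; [exact: within_continuous_cst|exact: cF].
move=> /subspace_continuousP/(_ x Ax)/cvgrPdist_lt/(_ e e0).
rewrite !near_withinE; apply: filterS => y + Ay => /(_ Ay).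
rewrite [X in `|X - _|]big1; last by move=> i _; rewrite big1 // => j _; rewrite subrr normr0.
rewrite sub0r normrN => /(le_lt_trans (ler_norm _)) xy.
have h1 := greatest_eigenvalue_lipschitz (low x Ax) (Fq y Ay).
have h2 := greatest_eigenvalue_lipschitz (low y Ay) (Fq x Ax).
have E : \sum_i \sum_j `|F y i j - F x i j| = \sum_i \sum_j `|F x i j - F y i j|.
  by apply: eq_bigr => i _; apply: eq_bigr => j _; rewrite distrC.
rewrite /from_subspace in xy *; rewrite E in h1; rewrite ltr_norml; apply/andP; split; lra.
Qed.

End MatrixContinuity.

(** * The energy of a solution *)

Lemma surf_int_ae0 (R : realType) (dA : {finite_measure set (R * R * R)%type -> \bar R})
    (A : set 'rV[R]_3) (f : 'rV[R]_3 -> R) :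
  measurable (pt @^-1` A) -> measurable_fun (pt @^-1` A) (fun p => f (pt p)) ->
  {ae dA, forall p, A (pt p) -> f (pt p) = 0} -> surf_int dA A f = 0.
Proof.
move=> mA mf f0; rewrite /surf_int /Rintegral.
rewrite (@ae_eq_integral _ _ _ dA _ (cst 0%E)) //.
- by rewrite integral0.
- exact/measurable_realfun.measurable_EFinP.
- by apply: filterS f0 => p pA Ap /=; rewrite pA.
Qed.

Lemma antideriv_quad (R : realType) (A : 'M[R]_3) (u u' v v' : 'I_3 -> R -> R) :
  (forall i, antideriv (u i) (u' i)) -> (forall i, antideriv (v i) (v' i)) ->
  antideriv (fun t => quad A (u ^~ t) (v ^~ t))
    (fun t => quad A (u' ^~ t) (v ^~ t) + quad A (u ^~ t) (v' ^~ t)).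
Proof.
move=> du dv.
have aQ := antideriv_sum (fun i => antideriv_sum (fun j => antiderivM
  (antiderivZ (A i j) (du i)) (dv j))).
apply: (eq_antideriv aQ) => // t _.
rewrite /quad -big_split; apply: eq_bigr => i _; rewrite -big_split.
by apply: eq_bigr => j _ /=; ring.
Qed.

Section Solution.
Context {R : realType} (B : set 'rV[R]_3) (n : 'rV[R]_3 -> 'rV[R]_3)
  (dA : {finite_measure set (R * R * R)%type -> \bar R})
  (Sigma1 Sigma2 : set 'rV[R]_3) (m : medium R) (D : data R)
  (T : 'rV[R]_3 -> R -> R) (q : 'I_3 -> 'rV[R]_3 -> R -> R).
Notation E3 := 'rV[R]_3.
Notation C := (closure B).
Notation half := [set t : R | 0 <= t].
Notation continuous_half h := {within [set t : R | 0 <= t], continuous h}.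
Notation tq := (tau_q m).
Notation tT := (tau_T m).
Notation e_ i := (delta_mx 0 i : E3).
Context (region : regular_region B n dA)
  (cover : closure Sigma1 `|` Sigma2 = boundary B)
  (reg : regular_medium B m) (smooth : smooth_data B Sigma1 Sigma2 D)
  (zero : zero_boundary_data Sigma1 Sigma2 D)
  (posdef : positive_definite B (cond m))
  (capacity_gt0 : forall x, C x -> 0 < capacity m x)
  (sol : solution B n Sigma1 Sigma2 m D T q).
(** [G], [V] and [H] are the continuous extensions to the closed cylinder of
    the space derivatives of [T], and of the time and space derivatives of [q].
    Outside [B] and at time 0 the derivatives themselves carry no information. *)
Context (G V : 'I_3 -> E3 -> R -> R) (H : 'I_3 -> 'I_3 -> E3 -> R -> R).
Context (cG : forall i, cont_cyl C (G i))
  (GE : forall i x t, B x -> 0 < t -> dx i T x t = G i x t)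
  (cV : forall i, cont_cyl C (V i))
  (VE : forall i x t, B x -> 0 < t -> dt (q i) x t = V i x t)
  (cH : forall i j, cont_cyl C (H i j))
  (HE : forall i j x t, B x -> 0 < t -> dx j (q i) x t = H i j x t).

Let openB : open B. Proof. by case: region => -[]. Qed.
Let boundedB : bounded_set B. Proof. by case: region => -[]. Qed.
Let BC x : B x -> C x. Proof. exact: subset_closure. Qed.

Let cT : cont_cyl C T. Proof. by case: sol => -[[]]. Qed.
Let cq i : cont_cyl C (q i). Proof. by case: sol => -[_ /(_ i)[]]. Qed.

Let dT i x t : B x -> 0 < t -> is_derive x (e_ i) (T ^~ t) (G i x t).
Proof.
move=> Bx t0; rewrite -GE //; case: sol => -[[_ _ /(_ i)[dTi _] _] _] _ _ _ _.
by split; [exact: dTi|].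
Qed.

Let dq i j x t : B x -> 0 < t -> is_derive x (e_ j) (q i ^~ t) (H i j x t).
Proof.
move=> Bx t0; rewrite -HE //; case: sol => -[_ /(_ i)[_ _ _ /(_ j)[dqi _]]] _ _ _ _.
by split; [exact: dqi|].
Qed.

Lemma is_derive_space_tilde (f : E3 -> R -> R) (F : E3 -> R -> R) i x t :
  cont_cyl C f -> cont_cyl C F ->
  (forall y s, B y -> 0 < s -> is_derive y (e_ i) (f ^~ s) (F y s)) ->
  B x -> 0 <= t ->
  is_derive x (e_ i) (fun y => tilde tT (f y) t) (tilde tT (F x) t).
Proof.
move=> cf cF fF Bx t0.
have d1 := is_derive_space_prim openB cf cF fF Bx t0.
have d2 := is_derive_space_ge0 openB cf cF fF Bx t0.
exact: (is_deriveD d1 (is_deriveZ tT d2)).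
Qed.

Lemma cont_cyl_tilde f : cont_cyl C f -> cont_cyl C (fun x => tilde tT (f x)).
Proof.
move=> cf; have c1 := cont_cyl_prim cf.
have c2 := within_continuousM (@within_continuous_cst R _ (C `*` half) tT) cf.
exact: (within_continuousD c1 c2).
Qed.

Lemma antideriv_q i x : B x -> antideriv (q i x) (V i x).
Proof.
move=> Bx; split; first exact: (cont_cyl_time (@cq i) (BC Bx)).
move=> t t0; rewrite -VE //; case: sol => -[_ /(_ i)[_ [dqi _] _ _]] _ _ _ _.
by split; [exact: dqi|rewrite /dt derive1E].
Qed.

Lemma antideriv_V i x : B x -> antideriv (V i x) (dt (dt (q i)) x).
Proof.
move=> Bx; split; first exact: (cont_cyl_time (@cV i) (BC Bx)).
move=> t t0; case: sol => -[_ /(_ i)[_ _ [dqi _] _]] _ _ _ _.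
apply: (@near_eq_is_derive _ _ _ (dt (q i) x)).
  by near=> s; apply: VE => //; near: s; exact: lt_nbhsr.
by split; [exact: dqi|rewrite /dt derive1E].
Unshelve. all: by end_near. Qed.

Lemma antideriv_G i x : B x -> antideriv (G i x) (dt (dx i T) x).
Proof.
move=> Bx; split; first exact: (cont_cyl_time (@cG i) (BC Bx)).
move=> t t0; case: sol => -[[_ _ _ /(_ i)[dTi _]] _] _ _ _ _.
apply: (@near_eq_is_derive _ _ _ (dx i T x)).
  by near=> s; apply: GE => //; near: s; exact: lt_nbhsr.
by split; [exact: dTi|rewrite /dt derive1E].
Unshelve. all: by end_near. Qed.

Lemma antideriv_T x : B x -> antideriv (T x) (dt T x).
Proof.
move=> Bx; split; first exact: (cont_cyl_time cT (BC Bx)).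
move=> t t0; case: sol => -[[_ [dTi _] _ _] _] _ _ _ _.
by split; [exact: dTi|rewrite /dt derive1E].
Qed.

Lemma q_initial i x : C x -> q i x 0 = q_init D i x.
Proof. by move=> Cx; case: sol => _ _ _ /(_ x Cx)[_ + _] _; exact. Qed.

Lemma T_initial x : C x -> T x 0 = T_init D x.
Proof. by move=> Cx; case: sol => _ _ _ /(_ x Cx)[]. Qed.

(** The initial condition prescribes a one-sided derivative. *)
Lemma V_initial i x : B x -> V i x 0 = qdot_init D i x.
Proof.
move=> Bx; apply: (antideriv_right_derivative (antideriv_q i Bx)).
  exact: (cont_cyl_time (@cV i) (BC Bx)).
by case: sol => _ _ _ /(_ x (BC Bx))[_ _ +] _; exact.
Qed.

Lemma G_initial i x : B x -> pdx i (T_init D) x = G i x 0.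
Proof.
move=> Bx; have [_ <-] := is_derive_space_ge0 openB cT (@cG i) (@dT i) Bx (lexx 0).
apply: near_eq_derive; near=> y; rewrite T_initial //; apply: BC; near: y.
exact: open_nbhs_nbhs.
Unshelve. all: by end_near. Qed.

(** The letters are those of the formulas at the top, with [V] for v: [gT] and
    [Ht] are the gradient of [Tt] and the derivatives of [qt].  The function
    [phi_ext] extends [phi] to the boundary of [B], where the gradient of the
    initial temperature has no meaning. *)
Let K := resist m.
Let p i x := prim (q i x).
Let Tt x := tilde tT (T x).
Let gT i x := tilde tT (G i x).
Let qt i x := tilde tT (q i x).
Let Ht i j x := tilde tT (H i j x).
Let flux_init i x := tq * q_init D i x + 2^-1 * tq ^+ 2 * qdot_init D i x.
Let phi_ext i x := tT * G i x 0 + \sum_j K x i j * flux_init j x.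

Let ksym x : C x -> (cond m x)^T = cond m x. Proof. by case: reg => _ + _ _ _; exact. Qed.
Let klow x : C x -> 0 < lowest_eigenvalue (cond m x). Proof. by move=> /posdef[]. Qed.
Let kquad x : C x -> forall u,
  lowest_eigenvalue (cond m x) * sqnorm u <= quad (cond m x) u u /\
  quad (cond m x) u u <= greatest_eigenvalue (cond m x) * sqnorm u.
Proof. by move=> /posdef[]. Qed.
Let kunit x : C x -> cond m x \in unitmx.
Proof. by move=> Cx; exact: posdef_unit (klow Cx) (kquad Cx). Qed.

Lemma phi_extE i x : B x -> phi m D i x = phi_ext i x.
Proof. by move=> Bx; rewrite /phi /phi_ext G_initial. Qed.

(** The constitutive equation says that both sides have the same time
    derivative, and [phi] is what makes them agree at time 0. *)
Lemma integrated_constitutive i x t : B x -> 0 <= t ->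
  p i x t + tq * q i x t + 2^-1 * tq ^+ 2 * V i x t =
  \sum_j cond m x i j * (phi_ext j x - gT j x t).
Proof.
move=> Bx t0.
have cqx := cont_cyl_time (@cq i) (BC Bx).
have cGx j := cont_cyl_time (@cG j) (BC Bx).
have aU := antiderivD (antiderivD (antideriv_prim cqx) (antiderivZ tq (antideriv_q i Bx)))
  (antiderivZ (2^-1 * tq ^+ 2) (antideriv_V i Bx)).
have aW := antiderivZ (-1) (antideriv_sum (fun j => antiderivZ (cond m x i j)
  (antiderivD (antideriv_prim (@cGx j)) (antiderivZ tT (antideriv_G j Bx))))).
have := antideriv_unique aU aW t0 _.
rewrite prim0 add0r (q_initial _ (BC Bx)) (V_initial _ Bx) -/(flux_init i x) => E.
have {}E := E _.
have Ek : \sum_j cond m x i j * (phi_ext j x - gT j x t) =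
  flux_init i x + \sum_j cond m x i j * (tT * G j x 0) - \sum_j cond m x i j * gT j x t.
  under eq_bigr do rewrite /phi_ext mulrBr mulrDr.
  rewrite sumrB big_split /= addrC; congr (_ + _ - _).
  have -> : flux_init i x = (cond m x *m (K x *m \col_l flux_init l x)) i 0.
    by rewrite mulmxA (mulmxV (kunit (BC Bx))) mul1mx mxE.
  by rewrite mxE; apply: eq_bigr => j _; rewrite sum_mx_col.
rewrite Ek; have -> : p i x t + tq * q i x t + 2^-1 * tq ^+ 2 * V i x t =
    (p i x t + tq * q i x t + 2^-1 * tq ^+ 2 * V i x t - flux_init i x) + flux_init i x.
  by ring.
rewrite E.
  have -> : \sum_j cond m x i j * (prim (G j x) 0 + tT * G j x 0) =
      \sum_j cond m x i j * (tT * G j x 0).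
    by apply: eq_bigr => j _; rewrite prim0 add0r.
  by rewrite /gT /tilde; ring.
move=> s /andP[s0 st]; case: sol => _ /(_ i x s Bx s0) ce _ _ _.
move: ce; rewrite VE // => ce; rewrite ce mulN1r.
under [in RHS]eq_bigr do rewrite mulrDr.
rewrite big_split /= opprD mulr_sumr; congr (- _ - _).
  by apply: eq_bigr => j _; rewrite GE.
by apply: eq_bigr => j _; ring.
Qed.

Lemma gradient_tilde i x t : B x -> 0 <= t ->
  gT i x t = phi_ext i x
    - \sum_j K x i j * (p j x t + tq * q j x t + 2^-1 * tq ^+ 2 * V j x t).
Proof.
move=> Bx t0.
have := solve_invmx (kunit (BC Bx)) (fun j => integrated_constitutive j Bx t0) i.
by rewrite /K /resist => <-; ring.
Qed.

Lemma measurable_boundary : measurable (pt @^-1` boundary B).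
Proof.
apply: closed_measurable_pt; rewrite /boundary setDE; apply: closedI.
  exact: closed_closure.
by apply: open_closedC; exact: open_interior.
Qed.

(** On one part of the boundary [T] vanishes at all times, on the other one the
    normal component of [q] does, and both properties survive time
    integration. *)
Lemma boundary_work t x : 0 <= t -> boundary B x -> outward_unit_normal B x (n x) ->
  \sum_i (Tt x t * qt i x t) * n x 0 i = 0.
Proof.
move=> t0 bx nx; have Cx : C x by case: bx.
have bT := antideriv_prim (cont_cyl_time cT Cx).
have bq := antideriv_sum (fun i => antiderivZ (n x 0 i)
  (antideriv_prim (cont_cyl_time (@cq i) Cx))).
under eq_bigr do rewrite -mulrA.
rewrite -mulr_sumr.
move: (bx); rewrite -cover; case: sol => _ _ _ _ [b1 b2] [S1|S2].
  have Tz s : 0 <= s -> T x s = 0 by move=> s0; rewrite b1 // (proj1 zero).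
  rewrite /Tt /tilde Tz // mulr0 addr0.
  have := antideriv_unique bT (antideriv_cst 0) t0 _; rewrite prim0 !subr0 => -> //.
    by rewrite mul0r.
  by move=> s /andP[/ltW s0 _]; exact: Tz.
have qz s : 0 <= s -> \sum_i q i x s * n x 0 i = 0.
  by move=> s0; rewrite b2 // (proj2 zero).
have := antideriv_unique bq (antideriv_cst 0) t0 _.
have -> : \sum_i n x 0 i * prim (q i x) 0 = 0.
  by apply: big1 => i _; rewrite prim0 mulr0.
rewrite subrr subr0 => E.
have {}E : \sum_i n x 0 i * prim (q i x) t = 0.
  apply: E => s /andP[/ltW s0 _]; rewrite -[RHS](qz s s0).
  by apply: eq_bigr => i _; rewrite mulrC.
rewrite (_ : \sum_i _ = \sum_i n x 0 i * prim (q i x) t + tT * \sum_i q i x t * n x 0 i).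
  by rewrite E qz // mulr0 addr0 mulr0.
rewrite mulr_sumr -big_split; apply: eq_bigr => i _ /=.
by rewrite /qt /tilde; ring.
Qed.

Let cTt : cont_cyl C Tt. Proof. exact: cont_cyl_tilde. Qed.
Let cqt i : cont_cyl C (qt i). Proof. exact: cont_cyl_tilde. Qed.
Let cgT i : cont_cyl C (gT i). Proof. exact: cont_cyl_tilde. Qed.
Let cHt i j : cont_cyl C (Ht i j). Proof. exact: cont_cyl_tilde. Qed.

Lemma divergence_work t : 0 <= t ->
  vol_int B (fun x => \sum_i (gT i x t * qt i x t + Tt x t * Ht i i x t)) = 0.
Proof.
move=> t0; case: region => _ nm nae gauss.
pose F i x := Tt x t * qt i x t.
have dF i j x : B x -> is_derive x (e_ j) (F i) (gT j x t * qt i x t + Tt x t * Ht i j x t).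
  move=> Bx.
  have d1 := is_derive_space_tilde cT (@cG j) (@dT j) Bx t0.
  have d2 := is_derive_space_tilde (@cq i) (@cH i j) (@dq i j) Bx t0.
  have := is_deriveM d1 d2; rewrite /GRing.scale /= addrC => d3.
  by apply: (is_derive_eq d3); rewrite mulrC.
have cF i : cont_on C (F i).
  have c1 := cont_cyl_slice cTt t0; have c2 := cont_cyl_slice (@cqt i) t0.
  exact: (within_continuousM c1 c2).
have := gauss F _; rewrite (_ : vol_int B _ =
    vol_int B (fun x => \sum_i (gT i x t * qt i x t + Tt x t * Ht i i x t))); last first.
  apply: eq_vol_int => x Bx; apply: eq_bigr => i _.
  by have [_ E] := dF i i x Bx; exact: E.
move=> ->.
  apply: surf_int_ae0.
  - exact: measurable_boundary.
  - have -> : (fun p => \sum_i F i (pt p) * n (pt p) 0 i) =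
        \sum_i (fun p => F i (pt p) * n (pt p) 0 i).
      by apply/funext => y; rewrite fct_sumE.
    elim/big_ind : _ => [|f g mf mg|i _].
    + exact: measurable_cst.
    + exact: measurable_realfun.measurable_funD.
    + apply: measurable_realfun.measurable_funM => //.
      apply: measurable_fun_pt; first exact: measurable_boundary.
      by apply: continuous_subspaceW (@cF i) => x [].
  - by apply: filterS nae => y Hy by_; apply: boundary_work => //; exact: Hy.
move=> i; split => // j; split.
  by move=> x Bx; have [] := dF i j x Bx.
exists (fun x => gT j x t * qt i x t + Tt x t * Ht i j x t); split; last first.
  by move=> x Bx; have [_ E] := dF i j x Bx; exact: E.
have c1 := cont_cyl_slice cTt t0; have c2 := cont_cyl_slice (@cqt i) t0.
have c3 := cont_cyl_slice (@cgT j) t0; have c4 := cont_cyl_slice (@cHt i j) t0.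
exact: (within_continuousD (within_continuousM c3 c2) (within_continuousM c1 c4)).
Qed.

(** Volume integrals are additive on functions continuous up to the boundary.
    Carrying the continuity along with the value allows the integration of a
    long linear combination in one step. *)
Definition has_vol (f : E3 -> R) (v : R) := cont_on C f /\ vol_int B f = v.

Lemma has_vol_int f : cont_on C f -> has_vol f (vol_int B f). Proof. by []. Qed.

Lemma has_volD f g v w : has_vol f v -> has_vol g w ->
  has_vol (fun x => f x + g x) (v + w).
Proof.
by move=> [cf <-] [cg <-]; split; [exact: within_continuousD|exact: vol_intD].
Qed.

Lemma has_volZ c f v : has_vol f v -> has_vol (fun x => c * f x) (c * v).
Proof.
move=> [cf <-]; split; last exact: vol_intZ.
exact: (within_continuousM (@within_continuous_cst R _ C c) cf).
Qed.

Lemma has_volB f g v w : has_vol f v -> has_vol g w ->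
  has_vol (fun x => f x - g x) (v - w).
Proof.
by move=> [cf <-] [cg <-]; split; [exact: within_continuousB|exact: vol_intB].
Qed.

Let Rs := Rstar m D.

Let cRs : cont_cyl C Rs.
Proof.
case: reg => _ _ ca crho _; case: smooth => cr [cT0 _] _ _ _.
have c1 := cont_cyl_space crho; have c2 := cont_cyl_space ca.
have c3 := cont_cyl_space cT0; have c4 := cont_cyl_tilde cr.
exact: (within_continuousD (within_continuousM c1 c4) (within_continuousM c2 c3)).
Qed.

Lemma antideriv_Tt x : B x -> antideriv (Tt x) (fun t => T x t + tT * dt T x t).
Proof.
move=> Bx; have := antideriv_prim (cont_cyl_time cT (BC Bx)).
by move=> /antiderivD/(_ (antiderivZ tT (antideriv_T Bx))).
Qed.

(** The energy equation is used twice: at time [t], and integrated from 0 to [t],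
    where the initial temperature in [Rstar] comes from. *)
Lemma integrated_energy x t : B x -> 0 < t ->
  capacity m x * (T x t + tT * dt T x t) = - (\sum_i Ht i i x t) + Rs x t.
Proof.
move=> Bx t0.
have en s : 0 < s -> capacity m x * dt T x s = - (\sum_i H i i x s) + density m x * src D x s.
  move=> s0; case: sol => _ _ /(_ x s Bx s0) <- _ _.
  by congr (- _ + _); apply: eq_bigr => i _; rewrite HE.
have csrc : cont_cyl C (src D) by case: smooth.
have aL := antiderivZ (capacity m x) (antideriv_T Bx).
have aR := antiderivD (antiderivZ (-1) (antideriv_sum (fun i => antideriv_prim
  (cont_cyl_time (@cH i i) (BC Bx))))) (antiderivZ (density m x) (antideriv_prim
  (cont_cyl_time csrc (BC Bx)))).
have := antideriv_unique aL aR (ltW t0) _.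
rewrite prim0 (T_initial (BC Bx)) mulr0 addr0.
have -> : \sum_i prim (H i i x) 0 = 0 by apply: big1 => i _; rewrite prim0.
rewrite mulr0 subr0 mulN1r => E.
have {}E := E _; rewrite mulrDr mulrCA en //.
have -> : capacity m x * T x t =
    - (\sum_i prim (H i i x) t) + density m x * prim (src D x) t + capacity m x * T_init D x.
  by rewrite -E ?subrK // => s /andP[s0 _]; rewrite en // mulN1r.
rewrite /Rs /Rstar /Ht /tilde big_split /= -mulr_sumr; ring.
Qed.

Let cK i j : cont_on C (fun x => K x i j).
Proof.
case: reg => ck _ _ _ _.
by apply: within_continuous_invmx => // x Cx; exact: kunit.
Qed.
Let cKc i j : cont_cyl C (fun x _ => K x i j). Proof. exact: (cont_cyl_space (@cK i j)). Qed.
Let cp i : cont_cyl C (p i). Proof. exact: (cont_cyl_prim (@cq i)). Qed.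

Let cquad (u v : 'I_3 -> E3 -> R -> R) : (forall i, cont_cyl C (u i)) ->
  (forall i, cont_cyl C (v i)) ->
  cont_cyl C (fun x t => quad (K x) (fun i => u i x t) (fun i => v i x t)).
Proof.
move=> cu cv.
exact: (@within_continuous_quad R _ (C `*` half) (fun y => K y.1)
  (fun i y => u i y.1 y.2) (fun i y => v i y.1 y.2) cKc cu cv).
Qed.

Let cphi_ext i : cont_on C (phi_ext i).
Proof.
have cflux j : cont_on C (flux_init j).
  case: smooth => _ _ /(_ j)[c1 c2] _ _.
  exact: (within_continuousD (within_continuousM (@within_continuous_cst R _ C tq) c1)
    (within_continuousM (@within_continuous_cst R _ C (2^-1 * tq ^+ 2)) c2)).
have c0 := cont_cyl_slice (@cG i) (lexx 0).
have c1 := within_continuousM (@within_continuous_cst R _ C tT) c0.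
have c2 : cont_on C (fun x => \sum_j K x i j * flux_init j x).
  apply: within_continuous_sum => j.
  exact: (within_continuousM (@cK i j) (@cflux j)).
exact: (within_continuousD c1 c2).
Qed.

Let cphi_dot (u : 'I_3 -> E3 -> R -> R) : (forall i, cont_cyl C (u i)) ->
  cont_cyl C (fun x t => \sum_i phi_ext i x * u i x t).
Proof.
move=> cu.
have cF i : cont_cyl C (fun x t => phi_ext i x * u i x t).
  exact: (within_continuousM (cont_cyl_space (@cphi_ext i)) (@cu i)).
exact: (@within_continuous_sum R _ (C `*` half) _ (index_enum _) xpredT
  (fun i y => phi_ext i y.1 * u i y.1 y.2) cF).
Qed.

Definition int_TT t := vol_int B (fun x => capacity m x * Tt x t ^+ 2).
Definition int_pp t := vol_int B (fun x => Kqq m x (fun i => p i x t)).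
Definition int_qq t := vol_int B (fun x => Kqq m x (fun i => q i x t)).
Definition int_qp t := vol_int B (fun x => quad (K x) (fun i => q i x t) (fun i => p i x t)).
Definition int_vp t := vol_int B (fun x => quad (K x) (fun i => V i x t) (fun i => p i x t)).
Definition int_vq t := vol_int B (fun x => quad (K x) (fun i => V i x t) (fun i => q i x t)).
Definition int_phip t := vol_int B (fun x => \sum_i phi_ext i x * p i x t).
Definition int_phiq t := vol_int B (fun x => \sum_i phi_ext i x * q i x t).
Definition int_TR t := vol_int B (fun x => Tt x t * Rs x t).
Definition int_RR t := vol_int B (fun x => (capacity m x)^-1 * Rs x t ^+ 2).
Definition int_Tdiv t := vol_int B (fun x => Tt x t * \sum_i Ht i i x t).
Definition int_phi2 := vol_int B (fun x => (K_low m x)^-1 * phi2 m D x).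

Let Ksym x : C x -> (K x)^T = K x.
Proof. by move=> Cx; apply: trmx_invmx; exact: ksym. Qed.

Let antideriv_p i x : B x -> antideriv (p i x) (q i x).
Proof. by move=> Bx; exact: antideriv_prim (cont_cyl_time (@cq i) (BC Bx)). Qed.

Lemma antideriv_int_pp : antideriv int_pp (fun t => 2 * int_qp t).
Proof.
have cX := cquad cq cp.
have c2X : cont_cyl C (fun x t => 2 * quad (K x) (fun i => q i x t) (fun i => p i x t)).
  exact: (within_continuousM (@within_continuous_cst R _ (C `*` half) 2) cX).
have := antideriv_vol_int openB boundedB (cquad cp cp) c2X _.
move=> A; apply: (eq_antideriv (A _)) => //.
  move=> x t Bx t0.
  have [_ /(_ t t0)] := antideriv_quad (K x) (fun i => antideriv_p i Bx)
    (fun i => antideriv_p i Bx).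
  rewrite [X in _ + X](quadC _ _ (Ksym (BC Bx))).
  by move=> d; apply: (is_derive_eq d); ring.
by move=> t t0; apply: vol_intZ => //; exact: (cont_cyl_slice cX (ltW t0)).
Qed.

Lemma antideriv_int_qp : antideriv int_qp (fun t => int_vp t + int_qq t).
Proof.
have c1 := cquad cV cp; have c2 := cquad cq cq.
have c3 : cont_cyl C (fun x t => quad (K x) (fun i => V i x t) (fun i => p i x t)
    + quad (K x) (fun i => q i x t) (fun i => q i x t)) := within_continuousD c1 c2.
have A := antideriv_vol_int openB boundedB (cquad cq cp) c3 _.
apply: (eq_antideriv (A _)) => //.
  move=> x t Bx t0.
  by have [_ /(_ t t0)] := antideriv_quad (K x) (fun i => antideriv_q i Bx)
    (fun i => antideriv_p i Bx).
move=> t t0; apply: vol_intD => //.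
  exact: (cont_cyl_slice c1 (ltW t0)).
exact: (cont_cyl_slice c2 (ltW t0)).
Qed.

Lemma antideriv_int_qq : antideriv int_qq (fun t => 2 * int_vq t).
Proof.
have cX := cquad cV cq.
have c2X : cont_cyl C (fun x t => 2 * quad (K x) (fun i => V i x t) (fun i => q i x t)).
  exact: (within_continuousM (@within_continuous_cst R _ (C `*` half) 2) cX).
have A := antideriv_vol_int openB boundedB (cquad cq cq) c2X _.
apply: (eq_antideriv (A _)) => //.
  move=> x t Bx t0.
  have [_ /(_ t t0)] := antideriv_quad (K x) (fun i => antideriv_q i Bx)
    (fun i => antideriv_q i Bx).
  rewrite [X in _ + X](quadC _ _ (Ksym (BC Bx))).
  by move=> d; apply: (is_derive_eq d); ring.
by move=> t t0; apply: vol_intZ => //; exact: (cont_cyl_slice cX (ltW t0)).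
Qed.

Lemma antideriv_int_phip : antideriv int_phip int_phiq.
Proof.
apply: (antideriv_vol_int openB boundedB (cphi_dot cp) (cphi_dot cq)) => x t Bx t0.
by have [_ /(_ t t0)] := antideriv_sum (fun i => antiderivZ (phi_ext i x) (antideriv_p i Bx)).
Qed.

Let cHsum : cont_cyl C (fun x t => \sum_i Ht i i x t).
Proof.
have cF i : cont_cyl C (Ht i i) := @cHt i i.
exact: (@within_continuous_sum R _ (C `*` half) _ (index_enum _) xpredT
  (fun i y => Ht i i y.1 y.2) cF).
Qed.

Let ca : cont_cyl C (fun x _ => capacity m x).
Proof. by case: reg => _ _ c1 _ _; exact: (cont_cyl_space c1). Qed.

Let cTR : cont_cyl C (fun x t => Tt x t * Rs x t).
Proof. exact: (within_continuousM cTt cRs). Qed.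

Let cTH : cont_cyl C (fun x t => Tt x t * \sum_i Ht i i x t).
Proof. exact: (within_continuousM cTt cHsum). Qed.

Lemma antideriv_int_TT : antideriv int_TT (fun t => 2 * (int_TR t - int_Tdiv t)).
Proof.
have cF : cont_cyl C (fun x t => capacity m x * Tt x t ^+ 2).
  exact: (within_continuousM ca (within_continuousX cTt)).
have cU : cont_cyl C (fun x t => 2 * (Tt x t * Rs x t - Tt x t * \sum_i Ht i i x t)).
  exact: (within_continuousM (@within_continuous_cst R _ (C `*` half) 2)
    (within_continuousB cTR cTH)).
have A := antideriv_vol_int openB boundedB cF cU _.
apply: (eq_antideriv (A _)) => //.
  move=> x t Bx t0.
  have [_ /(_ t t0)] := antiderivZ (capacity m x)
    (antiderivM (antideriv_Tt Bx) (antideriv_Tt Bx)).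
  move=> d; apply: (is_derive_eq d).
  have := integrated_energy Bx t0; move: (T x t + _) => y E.
  by rewrite mulrDr mulrA mulrCA E; ring.
move=> t t0; have h1 := has_vol_int (cont_cyl_slice cTR (ltW t0)).
have h2 := has_vol_int (cont_cyl_slice cTH (ltW t0)).
by have [_] := has_volZ 2 (has_volB h1 h2).
Qed.

(** The gradient of [Tt] in [divergence_work] is replaced by its value from
    [gradient_tilde], and the products are expanded. *)
Lemma work_balance t : 0 <= t ->
  int_Tdiv t = - (int_phip t + tT * int_phiq t)
    + (int_pp t + (tT + tq) * int_qp t + tq * tT * int_qq t
    + 2^-1 * tq ^+ 2 * int_vp t + 2^-1 * tq ^+ 2 * tT * int_vq t).
Proof.
move=> t0.
have hW := has_vol_int (cont_cyl_slice cTH t0).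
have hF := has_vol_int (cont_cyl_slice (cphi_dot cp) t0).
have hG := has_vol_int (cont_cyl_slice (cphi_dot cq) t0).
have hP := has_vol_int (cont_cyl_slice (cquad cp cp) t0).
have hX := has_vol_int (cont_cyl_slice (cquad cq cp) t0).
have hQ := has_vol_int (cont_cyl_slice (cquad cq cq) t0).
have hVP := has_vol_int (cont_cyl_slice (cquad cV cp) t0).
have hVQ := has_vol_int (cont_cyl_slice (cquad cV cq) t0).
have h := has_volD (has_volB (has_volD hF (has_volZ tT hG))
  (has_volD (has_volD (has_volD (has_volD hP (has_volZ (tT + tq) hX)) (has_volZ (tq * tT) hQ))
    (has_volZ (2^-1 * tq ^+ 2) hVP)) (has_volZ (2^-1 * tq ^+ 2 * tT) hVQ))) hW.
case: h => _ hv.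
have : 0 = int_phip t + tT * int_phiq t - (int_pp t + (tT + tq) * int_qp t + tq * tT * int_qq t
    + 2^-1 * tq ^+ 2 * int_vp t + 2^-1 * tq ^+ 2 * tT * int_vq t) + int_Tdiv t; last by lra.
rewrite -(divergence_work t0); apply: etrans hv; apply: eq_vol_int.
move=> x Bx; have Cx := BC Bx.
rewrite big_split /= -mulr_sumr; congr (_ + _).
under eq_bigr do rewrite (gradient_tilde _ Bx t0) mulrBl.
rewrite sumrB; congr (_ - _).
  rewrite mulr_sumr -big_split; apply: eq_bigr => i _ /=.
  by rewrite /qt /tilde /p; ring.
pose U j := p j x t + tq * q j x t + 2^-1 * tq ^+ 2 * V j x t.
have -> : \sum_i (\sum_j K x i j * U j) * qt i x t =
    quad (K x) (fun i => p i x t + tT * q i x t) U.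
  rewrite /quad; apply: eq_bigr => i _; rewrite mulr_suml; apply: eq_bigr => j _.
  by rewrite /qt /tilde /p; ring.
have E w : quad (K x) w U = quad (K x) w (fun i => p i x t)
    + tq * quad (K x) w (fun i => q i x t) + 2^-1 * tq ^+ 2 * quad (K x) w (fun i => V i x t).
  rewrite !(quadC w _ (Ksym Cx)) /U.
  by rewrite (quadDl _ (fun i => _ + _)) quadDl !quadZl.
rewrite quadDl quadZl !E.
rewrite (quadC (fun i => p i x t) (fun i => q i x t) (Ksym Cx)).
rewrite (quadC (fun i => p i x t) (fun i => V i x t) (Ksym Cx)).
rewrite (quadC (fun i => q i x t) (fun i => V i x t) (Ksym Cx)).
ring.
Qed.

Let tq0 : 0 <= tq. Proof. by case: reg => _ _ _ _ []. Qed.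
Let tT0 : 0 <= tT. Proof. by case: reg => _ _ _ _ []. Qed.

(** The products K v p, K v q, K q p and phi q in [work_balance] cancel against
    the derivatives of the terms K q p, K q q, K p p and phi p. *)
Lemma energy_balance : antideriv
  (fun t => 2^-1 * int_TT t + 2^-1 * (tq + tT) * int_pp t + 2^-1 * tq ^+ 2 * int_qp t
            + 4^-1 * tT * tq ^+ 2 * int_qq t - tT * int_phip t)
  (fun t => - int_pp t + tq * (tq / 2 - tT) * int_qq t + int_TR t + int_phip t).
Proof.
have aL := antiderivB (antiderivD (antiderivD (antiderivD (antiderivZ 2^-1 antideriv_int_TT)
  (antiderivZ (2^-1 * (tq + tT)) antideriv_int_pp))
  (antiderivZ (2^-1 * tq ^+ 2) antideriv_int_qp))
  (antiderivZ (4^-1 * tT * tq ^+ 2) antideriv_int_qq)) (antiderivZ tT antideriv_int_phip).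
by apply: (eq_antideriv aL) => // t t0; rewrite (work_balance (ltW t0)); field.
Qed.

Let hZ : has_vol (fun x => greatest_eigenvalue (cond m x) * sqnorm (phi_ext ^~ x)) int_phi2.
Proof.
split.
  have cg : cont_on C (fun x => greatest_eigenvalue (cond m x)).
    apply: within_continuous_greatest; first by case: reg.
      by move=> x Cx; exact: klow.
    by move=> x Cx u; exact: (kquad Cx u).2.
  have cs : cont_on C (fun x => sqnorm (phi_ext ^~ x)).
    apply: within_continuous_sum => i.
    exact: (within_continuousM (@cphi_ext i) (@cphi_ext i)).
  exact: (within_continuousM cg cs).
apply: eq_vol_int => x Bx; have Cx := BC Bx.
rewrite /K_low /resist (lowest_eigenvalue_invmx (klow Cx) (kquad Cx)); congr (_ * _).
by apply: eq_bigr => i _; rewrite phi_extE.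
Qed.

Let int_phi2_ge0 : 0 <= int_phi2.
Proof.
case: hZ => _ <-; apply: vol_int_ge0 => x Bx; have Cx := BC Bx.
rewrite mulr_ge0 //; first exact: ltW (greatest_eigenvalue_gt0 (klow Cx) (kquad Cx)).
by apply: sumr_ge0 => i _; rewrite -expr2 sqr_ge0.
Qed.

Lemma int_phip_le t : 0 <= t -> int_phip t <= 2^-1 * int_pp t + 2^-1 * int_phi2.
Proof.
move=> t0; have [cF _] := has_vol_int (cont_cyl_slice (cphi_dot cp) t0).
have [cG' <-] := has_volD (has_volZ 2^-1 (has_vol_int (cont_cyl_slice (cquad cp cp) t0)))
  (has_volZ 2^-1 hZ).
apply: vol_int_le => // x Bx; have Cx := BC Bx.
exact: quad_young (ksym Cx) (klow Cx) (kquad Cx) _ _.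
Qed.

Let cAF : cont_cyl C (fun x t => capacity m x * Tt x t ^+ 2).
Proof. exact: (within_continuousM ca (within_continuousX cTt)). Qed.

Let cRF : cont_cyl C (fun x t => (capacity m x)^-1 * Rs x t ^+ 2).
Proof.
have ca' : cont_on C (fun x => (capacity m x)^-1).
  apply: within_continuousV; last by case: reg.
  by move=> x Cx; rewrite gt_eqF // capacity_gt0.
exact: (within_continuousM (cont_cyl_space ca') (within_continuousX cRs)).
Qed.

(** Young's inequality with the weight [l * a]; the choice of [l] is postponed
    until after the integration in time. *)
Lemma int_TR_le t l : 0 <= t -> 0 < l -> int_TR t <= 2^-1 * (l * int_TT t + l^-1 * int_RR t).
Proof.
move=> t0 l0; have [cF _] := has_vol_int (cont_cyl_slice cTR t0).
have hA := has_vol_int (cont_cyl_slice cAF t0).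
have hR := has_vol_int (cont_cyl_slice cRF t0).
have [cG' <-] := has_volZ 2^-1 (has_volD (has_volZ l hA) (has_volZ l^-1 hR)).
apply: vol_int_le => // x Bx; have a0 := capacity_gt0 (BC Bx).
have la : 0 < l * capacity m x by rewrite mulr_gt0.
rewrite (mulrA l) (mulrA l^-1) -invfM.
move: (l * capacity m x) la => c c0; move: (Tt x t) (Rs x t) => y z.
rewrite -(ler_pM2r c0).
have -> : 2^-1 * (c * y ^+ 2 + c^-1 * z ^+ 2) * c = 2^-1 * (c ^+ 2 * y ^+ 2 + z ^+ 2).
  by field; rewrite gt_eqF.
by have := sqr_ge0 (c * y - z); lra.
Qed.

Let p0 i x : p i x 0 = 0. Proof. exact: prim0. Qed.

Lemma int_pp0 : int_pp 0 = 0.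
Proof.
apply: vol_int0 => // x _.
by apply: big1 => i _; apply: big1 => j _; rewrite !p0 mulr0.
Qed.

Lemma int_qp0 : int_qp 0 = 0.
Proof.
apply: vol_int0 => // x _.
by apply: big1 => i _; apply: big1 => j _; rewrite !p0 mulr0.
Qed.

Lemma int_phip0 : int_phip 0 = 0.
Proof.
apply: vol_int0 => // x _.
by apply: big1 => i _; rewrite p0 mulr0.
Qed.

Lemma data_boundE S : data_bound B m D T S =
  Num.sqrt (S * (2^-1 * int_TT 0 + 4^-1 * tT * tq ^+ 2 * int_qq 0 + 2^-1 * tT * int_phi2)
            + S ^+ 2 / 4 * int_phi2).
Proof.
rewrite /data_bound; congr Num.sqrt; congr (_ + _).
have hA := has_vol_int (cont_cyl_slice cAF (lexx 0)).
have hQ := has_vol_int (cont_cyl_slice (cquad cq cq) (lexx 0)).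
have [_ h] := has_volD (has_volD hA (has_volZ (2^-1 * tT * tq ^+ 2) hQ)) (has_volZ tT hZ).
rewrite (_ : vol_int B _ = int_TT 0 + 2^-1 * tT * tq ^+ 2 * int_qq 0 + tT * int_phi2).
  by field.
apply: etrans h; apply: eq_vol_int => x Bx; have Cx := BC Bx.
congr (_ + _ * _ + _).
  by apply: eq_bigr => i _; apply: eq_bigr => j _; rewrite !q_initial.
rewrite -mulrA /K_low /resist (lowest_eigenvalue_invmx (klow Cx) (kquad Cx)).
congr (_ * (_ * _)).
by apply: eq_bigr => i _; rewrite phi_extE.
Qed.

(** For [k = 0] the left-hand side is the energy E, for [k = tau_T tau_q^2 / 4] it
    is F. *)
Lemma solution_estimate (S k b t : R) : 0 <= b -> 0 <= k <= 4^-1 * tT * tq ^+ 2 ->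
  tq * (tq / 2 - tT) <= 2 * b * k -> 0 <= t <= S ->
  Num.sqrt (calE B m T q t + k * time_int t int_qq) <=
  (Num.sqrt 2)^-1 * time_int t (fun s => expR (b * (t - s)) * gfun B m D s)
  + expR (b * t) * data_bound B m D T S.
Proof.
move=> b0 kc bk tS; rewrite data_boundE.
have cA := continuous_vol_int openB boundedB cAF.
have cR := continuous_vol_int openB boundedB cRF.
have cP := antideriv_int_pp.1; have cQ := antideriv_int_qq.1.
have cPhi := antideriv_int_phip.1.
have cN := continuous_vol_int openB boundedB cTR.
have K0 x u : B x -> 0 <= Kqq m x u.
  by move=> Bx; have Cx := BC Bx; exact: quad_inv_ge0 (ksym Cx) (klow Cx) (kquad Cx) _.
apply: (energy_estimate tq0 tT0 int_phi2_ge0 cA cP cQ cN cPhi cR _ _ _ _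
  int_pp0 int_qp0 int_phip0 antideriv_int_pp energy_balance int_phip_le int_TR_le b0 kc bk tS).
- move=> s _; apply: vol_int_ge0 => x Bx; rewrite mulr_ge0 ?sqr_ge0 //.
  exact: ltW (capacity_gt0 (BC Bx)).
- by move=> s _; apply: vol_int_ge0 => x Bx; exact: K0.
- by move=> s _; apply: vol_int_ge0 => x Bx; exact: K0.
- move=> s _; apply: vol_int_ge0 => x Bx; rewrite mulr_ge0 ?sqr_ge0 ?invr_ge0 //.
  exact: ltW (capacity_gt0 (BC Bx)).
Qed.

End Solution.

Theorem theorem4 (R : realType)
    (B : set 'rV[R]_3) (n : 'rV[R]_3 -> 'rV[R]_3)
    (dA : {finite_measure set (R * R * R)%type -> \bar R})
    (Sigma1 Sigma2 : set 'rV[R]_3)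
    (m : medium R) (D : data R)
    (T : 'rV[R]_3 -> R -> R) (q : 'I_3 -> 'rV[R]_3 -> R -> R) (S : R) :
  regular_region B n dA ->
  Sigma1 `<=` boundary B -> Sigma2 `<=` boundary B ->
  closure Sigma1 `|` Sigma2 = boundary B -> Sigma1 `&` Sigma2 = set0 ->
  regular_medium B m ->
  smooth_data B Sigma1 Sigma2 D ->
  zero_boundary_data Sigma1 Sigma2 D ->
  positive_definite B (cond m) ->
  (0 <= tau_q m / 2 /\ tau_q m / 2 <= tau_T m) \/
  (0 < tau_T m /\ tau_T m < tau_q m / 2) ->
  (forall x, closure B x -> 0 < capacity m x) ->
  solution B n Sigma1 Sigma2 m D T q ->
  0 < S ->
  forall t : R, 0 <= t <= S ->
    (0 <= tau_q m <= 2 * tau_T m ->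
      Num.sqrt (calE B m T q t) <=
        (Num.sqrt 2)^-1 * time_int t (gfun B m D) + data_bound B m D T S)
    /\
    (0 < 2 * tau_T m < tau_q m ->
      Num.sqrt (calF B m T q t) <=
        (Num.sqrt 2)^-1 *
          time_int t (fun s => expR (sigma2 m * (t - s)) * gfun B m D s)
        + expR (sigma2 m * t) * data_bound B m D T S).
Proof.
move=> region _ _ cover _ reg smooth zero posdef _ cap sol _ t tS.
have [[_ _ regT _] regq] : temp_regular B T /\ flux_regular B q by case: sol.
have /choice[G HG] i : exists G : 'rV[R]_3 -> R -> R, cont_cyl (closure B) G /\
    (forall x s, B x -> 0 < s -> dx i T x s = G x s) by case: (regT i).
have /choice[V HV] i : exists V : 'rV[R]_3 -> R -> R, cont_cyl (closure B) V /\
    (forall x s, B x -> 0 < s -> dt (q i) x s = V x s) by case: (regq i) => _ [].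
have /choice[H HH] i : exists H : 'I_3 -> 'rV[R]_3 -> R -> R, forall j,
    cont_cyl (closure B) (H j) /\
    (forall x s, B x -> 0 < s -> dx j (q i) x s = H j x s).
  suff /choice[H HH] : forall j, exists H : 'rV[R]_3 -> R -> R, cont_cyl (closure B) H /\
    (forall x s, B x -> 0 < s -> dx j (q i) x s = H x s) by exists H.
  by move=> j; case: (regq i) => _ _ _ /(_ j)[].
have est := solution_estimate region cover reg smooth zero posdef cap sol
  (fun i => (HG i).1) (fun i => (HG i).2) (fun i => (HV i).1) (fun i => (HV i).2)
  (fun i j => (HH i j).1) (fun i j => (HH i j).2).
have [_ _ _ _ [tq0 tT0]] := reg.
split=> [/andP[_ tqT]|/andP[tT_gt0 tTq]].
  (* The term in [K q q] has the good sign, so that [k] and [b] may vanish. *)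
  have := est S 0 0 t (lexx 0).
  have c0 : 0 <= 4^-1 * tau_T m * tau_q m ^+ 2 by rewrite !mulr_ge0 ?invr_ge0 ?ler0n.
  have d0 : tau_q m * (tau_q m / 2 - tau_T m) <= 2 * 0 * 0.
    by rewrite mulr0 mulr_ge0_le0 //; lra.
  rewrite lexx => /(_ c0 d0 tS); rewrite !mul0r addr0 expR0 mul1r.
  suff -> : time_int t (fun s => expR (0 * (t - s)) * gfun B m D s) =
      time_int t (gfun B m D) by [].
  by apply: eq_prim => s _; rewrite mul0r expR0 mul1r.
(* With [b = sigma^2] and [k = tau_T tau_q^2 / 4], the product [2 b k] is the
   coefficient of the term of the wrong sign. *)
have tau_T0 : 0 < tau_T m by lra.
have tau_q0 : 0 < tau_q m by lra.
apply: (est S (4^-1 * tau_T m * tau_q m ^+ 2) (sigma2 m) t) => //.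
- rewrite /sigma2 subr_ge0 ler_pdivrMr // mulrC ler_pdivlMr //; lra.
- by rewrite lexx andbT !mulr_ge0 ?invr_ge0 ?ler0n.
- rewrite /sigma2 le_eqVlt; apply/orP; left; apply/eqP; field.
  by rewrite !gt_eqF.
Qed.
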